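(* Let $k$ be a field with $\operatorname{char}(k)\neq 2$ and let $X=X_0\sqcup X_1$ be a well-ordered set. Then the set $\mathrm{Tab}_s(X)$ of all GDN supertableaux over $X$ is a linear basis of the free GDN superalgebra $\mathrm{GDN}_s(X)$. Moreover, the GDN superalgebra homomorphism $\varphi:(\mathrm{GDN}_s(X),\circ)\to(k_s\{X\},\circ)$ determined by $\varphi(a)=a$ for all $a\in X$ is injective, where $k_s\{X\}$ is the free associative differential supercommutative algebra on $X$ and $u\circ v:=u\cdot D(v)$.
   Context: A superalgebra over $k$ is a vector space $\mathcal A=\mathcal A_0\oplus\mathcal A_1$ with a bilinear product $\circ$ such that $\mathcal A_i\circ\mathcal A_j\subseteq\mathcal A_{i+j}$ (indices mod 2); for nonzero $x\in\mathcal A_i$ write $|x|=i$. A (left) GDN (Gelfand–Dorfman–Novikov) superalgebra is a superalgebra satisfying, for all homogeneous $x,y,z$: $x\circ(y\circ z)-(x\circ y)\circ z=(-1)^{|x||y|}\big(y\circ(x\circ z)-(y\circ x)\circ z\big)$ (left supersymmetry) and $(x\circ y)\circ z=(-1)^{|y||z|}(x\circ z)\circ y$ (right supercommutativity). $X=X_0\sqcup X_1$ is a well-ordered set whose elements of $X_i$ have parity $i$; $\mathrm{GDN}_s(X)$ denotes the free GDN superalgebra over $k$ generated by $X$ (with $X_i$ of parity $i$). Terms over $X$: every $a\in X$ is a term, and if $\mu,\nu$ are terms then $(\mu\circ\nu)$ is a term; terms are regarded as elements of $\mathrm{GDN}_s(X)$. Write $[\mu_1,\dots,\mu_n]_L=((\cdots((\mu_1\circ\mu_2)\circ\mu_3)\cdots)\circ\mu_n)$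 and $[\mu_1,\dots,\mu_n]_R=(\mu_1\circ(\cdots\circ(\mu_{n-1}\circ\mu_n)\cdots))$. A simple term is $[a_1,\dots,a_n]_R$ with $a_i\in X$, $n\ge1$ (for $n=1$ it is the letter $a_1$). A GDN supertableau over $X$ is a term $\mu=[a,\mu_1,\dots,\mu_n]_L$ with $a\in X$, $n\ge0$, and simple terms $\mu_i=[a_{i,r_i},\dots,a_{i,1}]_R$ of length $r_i\ge1$, such that: (i) $r_1\ge r_2\ge\dots\ge r_n$; (ii) if $r_i=r_{i+1}$ then $a_{i,1}\ge a_{i+1,1}$; (iii) $a\ge a_{1,r_1}\ge\dots\ge a_{1,2}\ge a_{2,r_2}\ge\dots\ge a_{2,2}\ge\dots\ge a_{n,r_n}\ge\dots\ge a_{n,2}$; (iv) among the letters in the chain of (iii) (i.e. $a$ and all $a_{i,j}$ with $j\ge2$), any two occupying different positions and both lying in $X_1$ are distinct; (v) if $a_{i,1},a_{i+1,1}\in X_1$ and $r_i=r_{i+1}$ then $a_{i,1}\neq a_{i+1,1}$. $\mathrm{Tab}_s(X)$ is the set of all GDN supertableaux over $X$. An associative differential supercommutative algebra is an associative superalgebra $(\mathcal A,\cdot)$ (not necessarily unital) with $x\cdot y=(-1)^{|x||y|}y\cdot x$ for homogeneous $x,y$, together with a linear map $D$ preserving parity and satisfying $D(x\cdot y)=D(x)\cdot y+x\cdot D(y)$. $k_s\{X\}$ is the free such algebra on $X$ (with $X_i$ of parity $i$). *)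

(* Defs.v *)
From HB Require Import structures.
From mathcomp Require Import all_boot all_order all_algebra.
Set Implicit Arguments. Unset Strict Implicit. Unset Printing Implicit Defensive.
Import Order.TTheory GRing.Theory.
Local Open Scope ring_scope.

(* Superalgebras over a field k.  A Z/2-grading on a k-vector space V  *)
(* is given by  part : bool -> {pred V}  (false = even, true = odd).   *)
Section Super.
Variable k : fieldType.

Definition sgn (b : bool) : k := (-1) ^+ b.

Definition is_subspace (V : lmodType k) (P : {pred V}) : Prop :=
  0 \in P /\ forall (a : k) (u v : V), u \in P -> v \in P -> a *: u + v \in P.

Definition is_grading (V : lmodType k) (part : bool -> {pred V}) : Prop :=
  [/\ forall b, is_subspace (part b),
      forall x : V, exists x0 x1,
        [/\ x0 \in part false, x1 \in part true & x = x0 + x1]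
    & forall x : V, x \in part false -> x \in part true -> x = 0].

Definition is_bilinear (V : lmodType k) (m : V -> V -> V) : Prop :=
  (forall (a : k) (x y z : V), m (a *: x + y) z = a *: m x z + m y z) /\
  (forall (a : k) (x y z : V), m x (a *: y + z) = a *: m x y + m x z).

Definition graded_mul (V : lmodType k) (part : bool -> {pred V})
  (m : V -> V -> V) : Prop :=
  forall b c (x y : V), x \in part b -> y \in part c -> m x y \in part (b (+) c).

Definition superalg_axioms (V : lmodType k) (part : bool -> {pred V})
  (m : V -> V -> V) : Prop :=
  [/\ is_grading part, is_bilinear m & graded_mul part m].

Definition gdn_axioms (V : lmodType k) (part : bool -> {pred V})
  (m : V -> V -> V) : Prop :=
  superalg_axioms part m /\
  forall b c d (x y z : V), x \in part b -> y \in part c -> z \in part d ->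
    m x (m y z) - m (m x y) z = sgn (b && c) *: (m y (m x z) - m (m y x) z)
    /\ m (m x y) z = sgn (c && d) *: m (m x z) y.

Record GDNsuperalg := GDNSuperalg {
  gdn_car :> lmodType k;
  gdn_part : bool -> {pred gdn_car};
  gdn_mul : gdn_car -> gdn_car -> gdn_car;
  gdn_ax : gdn_axioms gdn_part gdn_mul }.

Definition is_linear (V W : lmodType k) (f : V -> W) : Prop :=
  forall (a : k) (x y : V), f (a *: x + y) = a *: f x + f y.

Definition preserves_parity (V W : lmodType k) (pV : bool -> {pred V})
  (pW : bool -> {pred W}) (f : V -> W) : Prop :=
  forall b x, x \in pV b -> f x \in pW b.

Definition gdn_hom (A B : GDNsuperalg) (f : A -> B) : Prop :=
  [/\ is_linear f, preserves_parity (@gdn_part A) (@gdn_part B) f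
    & forall x y : A, f (gdn_mul x y) = gdn_mul (f x) (f y)].

(* (F, i) is the free GDN superalgebra on X = X_0 |_| X_1, where
   par a = true iff a \in X_1 *)
Definition is_free_GDN (X : Type) (par : X -> bool) (F : GDNsuperalg)
  (i : X -> F) : Prop :=
  (forall a, i a \in @gdn_part F (par a)) /\
  forall (B : GDNsuperalg) (j : X -> B), (forall a, j a \in @gdn_part B (par a)) ->
    (exists f : F -> B, gdn_hom f /\ forall a, f (i a) = j a) /\
    (forall f g : F -> B, gdn_hom f -> gdn_hom g ->
       (forall a, f (i a) = j a) -> (forall a, g (i a) = j a) -> f =1 g).

Definition dsc_axioms (V : lmodType k) (part : bool -> {pred V})
  (m : V -> V -> V) (D : V -> V) : Prop :=
  [/\ superalg_axioms part m,
      forall x y z : V, m x (m y z) = m (m x y) z,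
      forall b c (x y : V), x \in part b -> y \in part c ->
        m x y = sgn (b && c) *: m y x,
      is_linear D /\ preserves_parity part part D
    & forall x y : V, D (m x y) = m (D x) y + m x (D y)].

Record DSCalg := DSCAlg {
  dsc_car :> lmodType k;
  dsc_part : bool -> {pred dsc_car};
  dsc_mul : dsc_car -> dsc_car -> dsc_car;
  dsc_D : dsc_car -> dsc_car;
  dsc_ax : dsc_axioms dsc_part dsc_mul dsc_D }.

Definition dsc_hom (A B : DSCalg) (f : A -> B) : Prop :=
  [/\ is_linear f, preserves_parity (@dsc_part A) (@dsc_part B) f,
      forall x y : A, f (dsc_mul x y) = dsc_mul (f x) (f y)
    & forall x : A, f (dsc_D x) = dsc_D (f x)].

Definition is_free_DSC (X : Type) (par : X -> bool) (K : DSCalg)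
  (j : X -> K) : Prop :=
  (forall a, j a \in @dsc_part K (par a)) /\
  forall (B : DSCalg) (j' : X -> B), (forall a, j' a \in @dsc_part B (par a)) ->
    (exists f : K -> B, dsc_hom f /\ forall a, f (j a) = j' a) /\
    (forall f g : K -> B, dsc_hom f -> dsc_hom g ->
       (forall a, f (j a) = j' a) -> (forall a, g (j a) = j' a) -> f =1 g).

End Super.

Inductive term (X : Type) := Leaf of X | Node of term X & term X.

Fixpoint term_eqb (X : eqType) (t u : term X) : bool :=
  match t, u with
  | Leaf a, Leaf b => a == b
  | Node t1 t2, Node u1 u2 => term_eqb t1 u1 && term_eqb t2 u2
  | _, _ => false
  end.

Lemma term_eqP (X : eqType) : Equality.axiom (@term_eqb X).
Proof.
elim=> [a|t1 IH1 t2 IH2] [b|u1 u2] /=; try by constructor.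
- by apply: (iffP eqP) => [->|[]].
- apply: (iffP andP) => [[/IH1 -> /IH2 ->]|[<- <-]] //.
  by split; [apply/IH1|apply/IH2].
Qed.

HB.instance Definition _ (X : eqType) := hasDecEq.Build (term X) (@term_eqP X).

Fixpoint eval_term (X A : Type) (m : A -> A -> A) (i : X -> A) (t : term X) : A :=
  match t with
  | Leaf a => i a
  | Node u v => m (eval_term m i u) (eval_term m i v)
  end.

Definition simple_term (X : Type) (b : X) (w : seq X) : term X :=
  foldr (fun x t => Node (Leaf x) t) (Leaf b) w.

(* A tableau datum is (a, ls) with ls = [:: (b_1, w_1); ...; (b_n, w_n)],
   encoding mu_i = [a_{i,r_i}, ..., a_{i,2}, a_{i,1}]_R with
   b_i = a_{i,1}, w_i = [:: a_{i,r_i}; ...; a_{i,2}], so r_i = size w_i + 1.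
   The term is [a, mu_1, ..., mu_n]_L. *)
Definition tab_term (X : Type) (a : X) (ls : seq (X * seq X)) : term X :=
  foldl (@Node X) (Leaf a) (map (fun p => simple_term p.1 p.2) ls).

Definition tab_data_ok (d : Order.disp_t) (X : orderType d) (par : X -> bool)
  (a : X) (ls : seq (X * seq X)) : bool :=
  let chain := a :: flatten (map snd ls) in
  [&&
      sorted geq (map (fun p => (size p.2).+1) ls),
      sorted (fun p q : X * seq X => (size p.2 == size q.2) ==>
                ((q.1 <= p.1)%O && ~~ [&& par p.1, par q.1 & p.1 == q.1])) ls,
      sorted (fun x y : X => (y <= x)%O) chain
    &
      uniq (filter par chain)].

Definition is_supertableau (d : Order.disp_t) (X : orderType d) (par : X -> bool)
  (t : term X) : Prop :=
  exists a ls, tab_data_ok par a ls /\ t = tab_term a ls.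

Definition is_linear_basis (k : fieldType) (V : lmodType k) (T : eqType)
  (P : T -> Prop) (e : T -> V) : Prop :=
  (forall v : V, exists (s : seq T) (c : T -> k),
      (forall t, t \in s -> P t) /\ v = \sum_(t <- s) c t *: e t) /\
  (forall (s : seq T) (c : T -> k), uniq s -> (forall t, t \in s -> P t) ->
      \sum_(t <- s) c t *: e t = 0 -> forall t, t \in s -> c t = 0).

(* Main.v *)
Require Import Defs.
From HB Require Import structures.
From mathcomp Require Import all_boot all_order all_algebra.
From mathcomp Require Import zify generic_quotient boolp.
Set Implicit Arguments.
Unset Strict Implicit.
Unset Printing Implicit Defensive.
Import Order.TTheory GRing.Theory.
Local Open Scope ring_scope.
Local Open Scope quotient_scope.

(* Spanning: filter the elements of each degree by the number n of arguments of
   [a, t_1, ..., t_n]_L.  Left supersymmetry a(yz) = +-y(az) + (ay)z -+ (ya)z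
   shows that, modulo more arguments, every argument may be taken simple and all
   letters outside the last places of the arguments supercommute; right
   supercommutativity permutes the arguments.  Hence, modulo more arguments, a
   term is zero or, up to sign, a supertableau, and the number of arguments is
   bounded by the degree.
   Independence: in a differential supercommutative algebra the image of a
   supertableau is, up to words with a smaller sum of squared derivation orders,
   the product of its chain letters and of the derivatives a_{i,1}^{(r_i)}.
   These leading monomials are nonzero and determine the supertableau, and
   their coefficients can be read off in a concrete model, which receives a
   morphism from the free algebra. *)

(** * Linear spans of predicates on vector spaces *)

Section LinearSpan.
Variable k : fieldType.
Implicit Types V W : lmodType k.

Lemma is_linear0 V W (f : V -> W) : is_linear f -> f 0 = 0.
Proof. by move=> /(_ (-1) 0 0); rewrite scaler0 add0r scaleN1r addNr. Qed.

Lemma is_linearD V W (f : V -> W) x y : is_linear f -> f (x + y) = f x + f y.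
Proof. by move=> /(_ 1 x y); rewrite !scale1r. Qed.

Lemma is_linearZ V W (f : V -> W) a x : is_linear f -> f (a *: x) = a *: f x.
Proof. by move=> fL; have := fL a x 0; rewrite (is_linear0 fL) !addr0. Qed.

Lemma is_linearB V W (f : V -> W) x y : is_linear f -> f (x - y) = f x - f y.
Proof.
by move=> fL; rewrite (is_linearD _ _ fL) -scaleN1r (is_linearZ _ _ fL) scaleN1r.
Qed.

(** Adding one generator at a time makes every closure property an induction; explicit coefficients
    appear only in [lspan_lin_comb]. *)
Inductive lspan V (P : V -> Prop) : V -> Prop :=
| lspan0 : lspan P 0
| lspanZD a u v : P u -> lspan P v -> lspan P (a *: u + v).

Lemma lspan_lin V W (P : V -> Prop) (Q : W -> Prop) (f : V -> W) v :
  is_linear f -> (forall u, P u -> lspan Q (f u)) -> lspan P v -> lspan Q (f v).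
Proof.
move=> fL PQ; elim=> [|a u w Pu _ IH]; first by rewrite is_linear0 //; left.
rewrite fL; elim: (PQ u Pu) => [|b x y Qx _ IHx]; first by rewrite scaler0 add0r.
by rewrite scalerDr scalerA -addrA; right.
Qed.

Lemma lspan_gen V (P : V -> Prop) u : P u -> lspan P u.
Proof. by move=> Pu; rewrite -[u]addr0 -[u]scale1r; right=> //; left. Qed.

Lemma lspanS V (P Q : V -> Prop) v :
  (forall u, P u -> lspan Q u) -> lspan P v -> lspan Q v.
Proof. by move=> PQ; apply: (@lspan_lin _ _ _ _ id). Qed.

Lemma lspanZ V (P : V -> Prop) a v : lspan P v -> lspan P (a *: v).
Proof.
elim=> [|b u w Pu _ IH]; first by rewrite scaler0; left.
by rewrite scalerDr scalerA; right.
Qed.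

Lemma lspanD V (P : V -> Prop) u v : lspan P u -> lspan P v -> lspan P (u + v).
Proof.
move=> Hu Hv; elim: Hu => [|b x w Px _ IH]; first by rewrite add0r.
by rewrite -addrA; right.
Qed.

Lemma lspanB V (P : V -> Prop) u v : lspan P u -> lspan P v -> lspan P (u - v).
Proof. by move=> Hu Hv; rewrite -scaleN1r; apply/lspanD/lspanZ. Qed.

Lemma sgn_add b c : sgn k b * sgn k c = sgn k (b (+) c).
Proof. by rewrite /sgn signr_addb. Qed.

Lemma sgnK V b (v : V) : sgn k b *: (sgn k b *: v) = v.
Proof. by rewrite scalerA sgn_add addbb scale1r. Qed.

Lemma lspan_lin_comb V (T : eqType) (P : T -> Prop) (e : T -> V) v :
  lspan (fun u => exists2 t, P t & u = e t) v ->
  exists (s : seq T) (c : T -> k),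
    [/\ uniq s, forall t, t \in s -> P t & v = \sum_(t <- s) c t *: e t].
Proof.
elim=> [|a _ w [t Pt ->] _ [s [c [us Ps ->]]]].
  by exists [::], (fun=> 0); rewrite big_nil; split.
(* If [t] already occurs in [s], it is removed and its old coefficient [cs] is merged into the new
   one, which keeps the list duplicate-free. *)
have Ps' : {in s, forall x, P x} by [].
pose s' := rem t s; pose cs := if t \in s then c t else 0.
have us' : uniq s' by apply: rem_uniq.
have tns' : t \notin s' by rewrite mem_rem_uniq // inE eqxx.
have Es : \sum_(x <- s) c x *: e x = cs *: e t + \sum_(x <- s') c x *: e x.
  rewrite /cs; case: ifP => [ts|/negbT tns].
    by rewrite (perm_big _ (perm_to_rem ts)) big_cons.
  by rewrite scale0r add0r /s' rem_id.
exists (t :: s'), (fun x => if x == t then a + cs else c x); split.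
- by rewrite /= tns'.
- by move=> x; rewrite inE => /orP[/eqP->//|/mem_rem]; apply: Ps.
rewrite Es big_cons eqxx addrA -scalerDl; congr (_ + _).
apply: eq_big_seq => x xs'; case: eqP => // xt.
by rewrite -xt xs' in tns'.
Qed.

End LinearSpan.

Lemma perm_eq_adjacent (T : eqType) (R : seq T -> seq T -> Prop) :
  (forall s, R s s) -> (forall s t u, R s t -> R t u -> R s u) ->
  (forall s x y t, R (s ++ x :: y :: t) (s ++ y :: x :: t)) ->
  forall s t, perm_eq s t -> R s t.
Proof.
move=> Rr Rt Ra s t st.
(* [R] is not assumed to be compatible with prepending letters, so the induction carries an
   arbitrary prefix [u]. *)
suff: forall u, R (u ++ s) (u ++ t) by move/(_ [::]).
elim: s t st => [|x s IH] t st u.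
  by rewrite perm_sym in st; rewrite (perm_nilP st).
 have xt : x \in t by rewrite -(perm_mem st) inE eqxx.
case/splitPr: xt st => t1 t2; rewrite -cat_rcons => st.
have {}st : perm_eq s (t1 ++ t2).
  by rewrite -(perm_cons x) (permPl st) cat_rcons perm_catC /= perm_cons perm_catC.
apply: (Rt _ (u ++ x :: t1 ++ t2)).
  by rewrite -!cat_rcons; apply: IH.
rewrite cat_rcons; elim: t1 u {st} => [|y t1 IH1] u; first exact: Rr.
apply: (Rt _ _ _ (Ra u x y (t1 ++ t2))).
rewrite -[y :: x :: _]cat1s catA.
by rewrite -[_ ++ (y :: t1) ++ _]/(u ++ [:: y] ++ t1 ++ x :: t2) catA; apply: IH1.
Qed.

(** * Spanning by supertableaux *)

Section Terms.
Variables (X : eqType) (par : X -> bool).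

Fixpoint tpar (t : term X) : bool :=
  match t with Leaf a => par a | Node u v => tpar u (+) tpar v end.

Fixpoint deg (t : term X) : nat :=
  match t with Leaf _ => 1 | Node u v => deg u + deg v end.

(** The left-normed product [[t, t_1, ..., t_n]_L]; by [term_app] every term has this form with a
    letter as head. *)
Definition app (t : term X) (ts : seq (term X)) : term X := foldl (@Node X) t ts.

Definition degs (ts : seq (term X)) : nat := sumn (map deg ts).

Lemma deg_gt0 t : (0 < deg t)%N.
Proof. by elim: t => //= u Hu v _; rewrite addn_gt0 Hu. Qed.

Lemma deg_app t ts : deg (app t ts) = (deg t + degs ts)%N.
Proof. by elim: ts t => [|u ts IH] t; rewrite /degs /= ?addn0 // IH /= addnA. Qed.

Lemma app_cat t ts us : app t (ts ++ us) = app (app t ts) us.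
Proof. exact: foldl_cat. Qed.

Lemma app_rcons t ts u : app t (rcons ts u) = Node (app t ts) u.
Proof. by rewrite -cats1 app_cat. Qed.

Lemma degs_cat ts us : degs (ts ++ us) = (degs ts + degs us)%N.
Proof. by rewrite /degs map_cat sumn_cat. Qed.

Lemma degs_cons t ts : degs (t :: ts) = (deg t + degs ts)%N.
Proof. by []. Qed.

Lemma degs_perm ts us : perm_eq ts us -> degs ts = degs us.
Proof. by move=> p; apply/perm_sumn/perm_map. Qed.

Lemma size_degs ts : (size ts <= degs ts)%N.
Proof.
by elim: ts => // t ts IH; rewrite degs_cons /= -add1n leq_add ?deg_gt0.
Qed.

Lemma term_app t : exists a ts, t = app (Leaf a) ts.
Proof.
elim: t => [a|u [a [ts ->]] v _]; first by exists a, [::].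
by exists a, (rcons ts v); rewrite app_rcons.
Qed.

Definition lmul (w : seq X) (t : term X) : term X :=
  foldr (fun x u => Node (Leaf x) u) t w.

Definition wpar (w : seq X) : bool := foldr (fun x b => par x (+) b) false w.

Lemma deg_lmul w t : deg (lmul w t) = (size w + deg t)%N.
Proof. by elim: w => //= x w ->. Qed.

Lemma tpar_lmul w t : tpar (lmul w t) = wpar w (+) tpar t.
Proof. by elim: w => //= x w ->; rewrite addbA. Qed.

Lemma wpar_cat u v : wpar (u ++ v) = wpar u (+) wpar v.
Proof. by elim: u => //= x u ->; rewrite addbA. Qed.

Definition args (ls : seq (X * seq X)) : seq (term X) :=
  map (fun p => simple_term p.1 p.2) ls.

(** Separates the shape of a tableau (last letters [a_{i,1}] with the numbers [r_i - 1], see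
    [lasts]) from the chain letters after the head, so that these can be permuted within a fixed
    shape. *)
Fixpoint arrange (cs : seq X) (bs : seq (X * nat)) : seq (X * seq X) :=
  if bs is (b, r) :: bs' then (b, take r cs) :: arrange (drop r cs) bs'
  else [::].

Definition lasts (ls : seq (X * seq X)) : seq (X * nat) :=
  [seq (p.1, size p.2) | p <- ls].

Lemma arrangeK ls : arrange (flatten (map snd ls)) (lasts ls) = ls.
Proof.
by elim: ls => //= -[b w] ls IH /=; rewrite take_size_cat // drop_size_cat ?IH.
Qed.

Lemma flatten_arrange cs bs : size cs = sumn (map snd bs) ->
  flatten (map snd (arrange cs bs)) = cs.
Proof.
elim: bs cs => [|[b r] bs IH] cs /=; first by move/size0nil->.
by move=> E; rewrite IH ?cat_take_drop // size_drop E addKn.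
Qed.

Lemma lasts_arrange cs bs : size cs = sumn (map snd bs) ->
  lasts (arrange cs bs) = bs.
Proof.
elim: bs cs => [|[b r] bs IH] cs //= E; rewrite IH ?size_drop ?E ?addKn //.
by rewrite size_takel // E leq_addr.
Qed.

Lemma size_arrange cs bs : size (arrange cs bs) = size bs.
Proof. by elim: bs cs => [|[b r] bs IH] cs //=; rewrite IH. Qed.

Lemma size_flatten_snd ls :
  size (flatten (map snd ls)) = sumn (map snd (lasts ls)).
Proof. by rewrite size_flatten /shape -!map_comp. Qed.

(** The decomposition is chosen before [y], so it is the same for two letters put at the same
    place. *)
Lemma arrange_split s1 s2 bs :
  (size s1 + (size s2).+1)%N = sumn (map snd bs) ->
  exists l1 b u1 u2 l2,
    forall y, arrange (s1 ++ y :: s2) bs = l1 ++ (b, u1 ++ y :: u2) :: l2.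
Proof.
elim: bs s1 => [|[b r] bs IH] s1 /= E; first by rewrite addnS in E.
have [r_s1|s1_r] := leqP r (size s1).
  have [|l1 [b' [u1 [u2 [l2 H]]]]] := IH (drop r s1).
    by rewrite size_drop; lia.
  exists ((b, take r s1) :: l1), b', u1, u2, l2 => y.
  rewrite /= takel_cat // -H drop_cat; case: (ltngtP r) r_s1 => // -> _.
  by rewrite subnn drop0 drop_size.
exists [::], b, s1, (take (r - size s1).-1 s2),
  (arrange (drop (r - size s1).-1 s2) bs) => y.
by rewrite take_cat drop_cat ltnNge (ltnW s1_r) /= -[in (r - _)%N](subnKC s1_r)
  addSnnS addKn.
Qed.

Lemma degs_args ls : degs (args ls) = (sumn (map snd (lasts ls)) + size ls)%N.
Proof.
elim: ls => //= -[b w] ls IH; rewrite degs_cons IH /=.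
by rewrite (deg_lmul w (Leaf b)) /=; lia.
Qed.

End Terms.

(** * Congruences modulo products with more arguments *)

Section Spanning.
Variables (k : fieldType) (A : GDNsuperalg k) (X : eqType) (par : X -> bool).
Variable i : X -> A.
Hypothesis i_part : forall a, i a \in @gdn_part k A (par a).

Local Notation "x ⋄ y" := (@gdn_mul k A x y) (at level 40, left associativity).
Local Notation ev := (eval_term (@gdn_mul k A) i).
Local Notation sgn := (sgn k).
Local Notation tpar := (tpar par).
Local Notation wpar := (wpar par).

Lemma ev_part t : ev t \in @gdn_part k A (tpar t).
Proof.
have [[_ _ Gm] _] := gdn_ax A.
by elim: t => [a|u Hu v Hv] /=; [apply: i_part|apply: Gm].
Qed.

Lemma mul_linearl x : is_linear (fun y => y ⋄ x).
Proof. by have [[_ [Bl _] _] _] := gdn_ax A => a y z; apply: Bl. Qed.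

Lemma mul_linearr x : is_linear (@gdn_mul k A x).
Proof. by have [[_ [_ Br] _] _] := gdn_ax A => a y z; apply: Br. Qed.

Lemma ev_rcom t u v :
  ev (Node (Node t u) v) = sgn (tpar u && tpar v) *: ev (Node (Node t v) u).
Proof.
have [_ /(_ _ _ _ (ev t) (ev u) (ev v))H] := gdn_ax A.
by have [] := H _ _ _ (ev_part t) (ev_part u) (ev_part v).
Qed.

Lemma ev_lsym t u v :
  ev (Node t (Node u v)) = sgn (tpar t && tpar u) *: ev (Node u (Node t v))
    + (ev (Node (Node t u) v)
       - sgn (tpar t && tpar u) *: ev (Node (Node u t) v)).
Proof.
have [_ /(_ _ _ _ (ev t) (ev u) (ev v))H] := gdn_ax A.
have [/= + _] := H _ _ _ (ev_part t) (ev_part u) (ev_part v).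
move=> /eqP; rewrite subr_eq => /eqP ->.
by rewrite scalerBr addrA addrAC.
Qed.

Definition amul (x : A) (ts : seq (term X)) : A :=
  foldl (fun y t => y ⋄ ev t) x ts.

Lemma ev_app t ts : ev (app t ts) = amul (ev t) ts.
Proof. by elim: ts t => //= u ts IH t; rewrite IH. Qed.

Lemma amul_linear ts : is_linear (fun x => amul x ts).
Proof.
elim: ts => [|t ts IH] a x y //=.
by rewrite -IH (mul_linearl (ev t)).
Qed.

(** The filtration of the part of degree [d] by the number of arguments; the summand [1] counts the
    head letter. *)
Definition fil (d n : nat) : A -> Prop :=
  lspan (fun u => exists a ts,
    [/\ u = ev (app (Leaf a) ts), (1 + degs ts)%N = d & (n <= size ts)%N]).

Lemma fil_app a ts d n : (1 + degs ts)%N = d -> (n <= size ts)%N ->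
  fil d n (ev (app (Leaf a) ts)).
Proof. by move=> *; apply: lspan_gen; exists a, ts. Qed.

Lemma fil_node2 t u v d : (deg t + deg u + deg v)%N = d ->
  fil d 2 (ev (Node (Node t u) v)).
Proof.
have [a [ts ->]] := term_app t; rewrite -!app_rcons deg_app => <-.
apply: fil_app; last by rewrite !size_rcons.
by rewrite -!cats1 !degs_cat /degs /= !addn0 !addnA.
Qed.

Lemma fil_amul d n x ts e m : fil d n x ->
  (d + degs ts)%N = e -> (m <= n + size ts)%N -> fil e m (amul x ts).
Proof.
move=> + <- mn; apply: lspan_lin (amul_linear ts) _ => u [a [us [-> <- nus]]].
rewrite -ev_app -app_cat; apply: fil_app; first by rewrite degs_cat addnA.
by rewrite size_cat (leq_trans mn) // leq_add2r.
Qed.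

Lemma app_swap t ts u v us :
  ev (app t (ts ++ u :: v :: us))
  = sgn (tpar u && tpar v) *: ev (app t (ts ++ v :: u :: us)).
Proof.
rewrite !app_cat !ev_app /= -!ev_app.
have := ev_rcom (app t ts) u v => /= ->.
by rewrite (is_linearZ _ _ (amul_linear us)).
Qed.

Lemma app_perm t ts us : perm_eq ts us ->
  exists s, ev (app t ts) = sgn s *: ev (app t us).
Proof.
move: ts us; apply: perm_eq_adjacent => [ts|ts us vs [s Es] [s' Es']|ts u v us].
- by exists false; rewrite scale1r.
- by exists (s (+) s'); rewrite Es Es' scalerA sgn_add.
- by eexists; apply: app_swap.
Qed.

(* Moves the composite argument next to a, where left supersymmetry
   [a (y z) = (a y) z +- (y (a z) - (y a) z)] produces more arguments. *)
Lemma fil_mul2 a ts h d e : fil e 2 h -> (1 + degs ts + e)%N = d ->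
  fil d (size ts + 2) (ev (app (Leaf a) ts) ⋄ h).
Proof.
move=> + <-; apply: lspan_lin (mul_linearr _) _ => _ [b [us [-> <- us2]]].
have -> : ev (app (Leaf a) ts) ⋄ ev (app (Leaf b) us)
  = ev (app (Leaf a) (rcons ts (app (Leaf b) us))) by rewrite app_rcons.
have [|s ->] := @app_perm (Leaf a) (rcons ts (app (Leaf b) us))
  (app (Leaf b) us :: ts); first by rewrite perm_rcons.
apply: lspanZ; rewrite ev_app /= -[_ ⋄ _]/(ev (Node (Leaf a) (app (Leaf b) us))).
apply: (@fil_amul (2 + degs us) 2); rewrite ?[(2 + size _)%N]addnC //; last by lia.
case/lastP: us us2 => // us z; rewrite size_rcons app_rcons ltnS => us1.
have Ed : (2 + degs (rcons us z) = 2 + degs us + deg z)%N.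
  by rewrite -cats1 degs_cat /degs /= addn0 addnA.
rewrite Ed ev_lsym.
apply: lspanD; [apply: lspanZ|apply: lspanB; last apply: lspanZ].
- rewrite -app_rcons; apply: fil_app; last by rewrite size_rcons.
  by rewrite -cats1 degs_cat /degs /=; lia.
- by apply: fil_node2; rewrite deg_app /=; lia.
- by apply: fil_node2; rewrite deg_app /=; lia.
Qed.

(** The sign is a parameter of the congruence, so transitivity adds signs modulo 2. *)
Definition cong (d n : nat) (s : bool) (u v : A) : Prop :=
  fil d n (u - sgn s *: v).

Lemma cong_eq d n s u v : u = sgn s *: v -> cong d n s u v.
Proof. by move=> ->; rewrite /cong subrr; left. Qed.

Lemma cong_trans d n s s' v u w :
  cong d n s u v -> cong d n s' v w -> cong d n (s (+) s') u w.
Proof.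
rewrite /cong => H1 H2; rewrite -sgn_add -scalerA -[u](subrK (sgn s *: v)).
by rewrite -addrA -scalerBr; apply/lspanD/lspanZ.
Qed.

Lemma cong_sym d n s u v : cong d n s u v -> cong d n s v u.
Proof.
move=> H; rewrite /cong -[v in v - _](sgnK s) -scalerBr -opprB scalerN -scaleNr.
exact: lspanZ.
Qed.

Lemma cong_sgn d n s s' u v : s = s' -> cong d n s u v -> cong d n s' u v.
Proof. by move->. Qed.

Lemma cong_mul2 a ts s u v d e : cong e 2 s u v -> (1 + degs ts + e)%N = d ->
  cong d (size ts + 2) s (ev (app (Leaf a) ts) ⋄ u) (ev (app (Leaf a) ts) ⋄ v).
Proof.
move=> H E; rewrite /cong -(is_linearZ _ _ (mul_linearr _)).
by rewrite -(is_linearB _ _ (mul_linearr _)); apply: fil_mul2 H E.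
Qed.

Lemma cong_amul d n s u v ts e m : cong d n s u v ->
  (d + degs ts)%N = e -> (m <= n + size ts)%N ->
  cong e m s (amul u ts) (amul v ts).
Proof.
move=> H E mn; rewrite /cong -(is_linearZ _ _ (amul_linear _)).
by rewrite -(is_linearB _ _ (amul_linear _)); apply: fil_amul E mn.
Qed.

(** By left supersymmetry the difference consists of [(a x) t] and [(x a) t], which have two
    arguments. *)
Lemma cong_swap a x t d : (2 + deg t)%N = d ->
  cong d 2 (par a && par x)
    (ev (Node (Leaf a) (Node (Leaf x) t))) (ev (Node (Leaf x) (Node (Leaf a) t))).
Proof.
move=> E; rewrite /cong ev_lsym addrC addKr.
by apply: lspanB; last apply: lspanZ; apply: fil_node2.
Qed.

Lemma cong_bubble w x t d : (1 + size w + deg t)%N = d ->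
  cong d 2 (wpar w && par x) (ev (lmul w (Node (Leaf x) t)))
                             (ev (Node (Leaf x) (lmul w t))).
Proof.
elim: w d => [|y w IH] d E /=; first by apply: cong_eq; rewrite scale1r.
rewrite andb_addl addbC; apply: cong_trans.
  by apply: (@cong_mul2 y [::] _ _ _ _ d.-1); [apply: IH|]; rewrite -E.
by apply: (@cong_swap y x (lmul w t)); rewrite deg_lmul -E.
Qed.

Lemma cong_head a x t ts d : (2 + deg t + degs ts)%N = d ->
  cong d (size ts + 2) (par a && par x)
    (ev (app (Leaf a) (Node (Leaf x) t :: ts)))
    (ev (app (Leaf x) (Node (Leaf a) t :: ts))).
Proof.
move=> E; rewrite !ev_app /=.
apply: (@cong_amul (2 + deg t) 2); last by rewrite addnC.
  exact: cong_swap.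
exact: E.
Qed.

(** The argument containing [x] is moved to the front, and [x] to the front of that argument;
    [cong_head] exchanges it with [a], and the first moves are undone. For sorting it is enough that
    some sign exists. *)
Lemma cong_star a x u1 u2 b ts1 ts2 d :
  (2 + size u1 + size u2 + deg b + degs ts1 + degs ts2)%N = d ->
  exists s, cong d ((size ts1 + size ts2).+2) s
    (ev (app (Leaf a) (ts1 ++ lmul (u1 ++ x :: u2) b :: ts2)))
    (ev (app (Leaf x) (ts1 ++ lmul (u1 ++ a :: u2) b :: ts2))).
Proof.
move=> E.
have front c y : exists s, cong d ((size ts1 + size ts2).+2) s
    (ev (app (Leaf c) (ts1 ++ lmul (u1 ++ y :: u2) b :: ts2)))
    (ev (app (Leaf c) (Node (Leaf y) (lmul (u1 ++ u2) b) :: ts1 ++ ts2))).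
  have [|s Es] := @app_perm (Leaf c) (ts1 ++ lmul (u1 ++ y :: u2) b :: ts2)
    (lmul (u1 ++ y :: u2) b :: ts1 ++ ts2).
    exact/permPl/(perm_catCA ts1 [:: _] ts2).
  eexists; apply: cong_trans; first exact: cong_eq Es.
  rewrite !ev_app /=.
  apply: (@cong_amul (2 + size u1 + size u2 + deg b) 2); last by rewrite size_cat.
    apply: (@cong_mul2 c [::] _ _ _ _ (1 + size u1 + size u2 + deg b)) => //.
    rewrite /lmul !foldr_cat /= -!/(lmul _ _).
    by apply: cong_bubble; rewrite deg_lmul addnA.
  by rewrite degs_cat addnA.
have [s1 C1] := front a x; have [s2 C2] := front x a.
eexists; apply: cong_trans C1 _; apply: cong_trans (cong_sym C2).
have := @cong_head a x (lmul (u1 ++ u2) b) (ts1 ++ ts2) d.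
rewrite size_cat addn2; apply.
by rewrite deg_lmul size_cat degs_cat -E; lia.
Qed.

(* Exchanging the last parts nu, nu' of two arguments whose other letters are
   u, u' carries exactly the Koszul sign of the word u nu u' nu'. *)
Lemma cong_tails a u u' v v' d : size u = size u' ->
  (1 + 2 * size u + deg v + deg v')%N = d ->
  cong d 3 (tpar v && tpar v' (+) (tpar v (+) tpar v') && wpar u')
    (ev (app (Leaf a) [:: lmul u v; lmul u' v']))
    (ev (app (Leaf a) [:: lmul u v'; lmul u' v])).
Proof.
have arg1 (c : X) p q r s e : cong (deg p) 2 s (ev p) (ev q) ->
    (1 + deg p + deg r)%N = e ->
    cong e 3 s (ev (app (Leaf c) [:: p; r])) (ev (app (Leaf c) [:: q; r])).
  move=> H E; rewrite !ev_app.
  apply: (@cong_amul (1 + deg p) 2 _ _ _ [:: r]) => //.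
    exact: (@cong_mul2 c [::]) H _.
  by rewrite /degs /= addn0.
have arg2 (c : X) p q r s e : cong (deg p) 2 s (ev p) (ev q) ->
    (1 + deg p + deg r)%N = e ->
    cong e 3 s (ev (app (Leaf c) [:: r; p])) (ev (app (Leaf c) [:: r; q])).
  move=> H E; apply: (@cong_mul2 c [:: r]) H _.
  by rewrite /degs /= addn0 addnAC.
(* The last letters [x], [x'] of [u], [u'] are absorbed into the tails, and the induction hypothesis
   exchanges [x v] with [x' v']; it remains to exchange [x] and [x'] back. The base case is right
   supercommutativity. *)
elim/last_ind: u u' v v' d => [|u x IH] u' v v' d.
  case: u' => // _ E; rewrite andbF addbF.
  exact/cong_eq/(app_swap (Leaf a) [::] v v' [::]).
case/lastP: u' => [|u' x']; rewrite !size_rcons // => -[Eu] E.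
rewrite /lmul !foldr_rcons -!/(lmul _ _).
apply: cong_sgn; last first.
  apply: cong_trans (IH _ (Node (Leaf x) v) (Node (Leaf x') v') d Eu _) _.
    by rewrite -E /=; lia.
  apply: cong_trans; first apply: arg1.
  - by apply: (@cong_bubble u x' v'); rewrite deg_lmul /= addnA addn1.
  - by rewrite !deg_lmul -E /=; lia.
  apply: cong_trans; first apply: arg2.
  - by apply: (@cong_bubble u' x v); rewrite deg_lmul /= addnA addn1.
  - by rewrite /= !deg_lmul -E /=; lia.
  (* [x] and [x'] are now first in their arguments. They are transposed by three exchanges with the
     head: [a] with [x'], [x'] with [x], [x] with [a]. *)
  set p := lmul u v'; set q := lmul u' v.
  have Ed : (2 + deg p + degs [:: Node (Leaf x) q])%N = d.
    by rewrite /degs /= !deg_lmul -E; lia.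
  apply: cong_trans (@cong_head a x' p [:: Node (Leaf x) q] _ Ed) _.
  apply: cong_trans (cong_eq _ _ (app_swap (Leaf x') [::] _ _ [::])) _.
  have Ed' : (2 + deg q + degs [:: Node (Leaf a) p])%N = d.
    by rewrite /degs /= !deg_lmul -E; lia.
  apply: cong_trans (@cong_head x' x q [:: Node (Leaf a) p] _ Ed') _.
  apply: cong_trans (cong_eq _ _ (app_swap (Leaf x) [::] _ _ [::])) _.
  have Ed'' : (2 + deg p + degs [:: Node (Leaf x') q])%N = d.
    by rewrite /degs /= !deg_lmul -E; lia.
  apply: cong_trans (@cong_head x a p [:: Node (Leaf x') q] _ Ed'') _.
  apply: cong_trans; first apply/cong_sym/arg1.
  - by apply: (@cong_bubble u x v'); rewrite deg_lmul /= addnA addn1.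
  - by rewrite /q !deg_lmul -E /= !deg_lmul; lia.
  apply/cong_sym/arg2.
  - by apply: (@cong_bubble u' x' v); rewrite deg_lmul /= addnA addn1.
  - by rewrite /p -E /= !deg_lmul /=; lia.
rewrite /= -!cats1 !wpar_cat !tpar_lmul /= !addbF.
by move: (tpar v) (tpar v') (wpar u) (wpar u') (par a) (par x) (par x');
   do 7!case.
Qed.

(** By multilinearity the arguments can be expanded one after another. *)
Lemma expand_args (P : term X -> Prop) t ts :
  (forall u, u \in ts ->
     lspan (fun v => exists w, [/\ v = ev w, P w & deg w = deg u]) (ev u)) ->
  lspan (fun v => exists us, [/\ v = ev (app t us), size us = size ts,
                   degs us = degs ts & forall u, u \in us -> P u])
    (ev (app t ts)).
Proof.
elim: ts t => [|u ts IH] t H; first by apply: lspan_gen; exists [::].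
apply: lspanS (IH (Node t u) _) => [_ [us [-> Es Ed Pus]]|w wts]; last first.
  by apply: H; rewrite inE wts orbT.
have L : is_linear (fun x => amul (ev t ⋄ x) us).
  by move=> c x y; rewrite (mul_linearr (ev t)) (amul_linear us).
rewrite ev_app; apply: lspan_lin L _ (H u _); last by rewrite inE eqxx.
move=> _ [w [-> Pw Edw]]; apply: lspan_gen; exists (w :: us); split.
- by rewrite ev_app.
- by rewrite /= Es.
- by rewrite !degs_cons Edw Ed.
- by move=> x; rewrite inE => /orP[/eqP->|/Pus].
Qed.

(** Head and chain letters form one list, to be permuted freely. The value [0] on the empty list is
    a default, excluded in [cong_chain] by the size hypothesis. *)
Definition ev_chain (c : seq X) (bs : seq (X * nat)) : A :=
  if c is a :: cs then ev (tab_term a (arrange cs bs)) else 0.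

Lemma cong_chain c c' bs d : perm_eq c c' ->
  size c = (sumn (map snd bs)).+1 -> (size c + size bs)%N = d ->
  exists s, cong d (size bs).+1 s (ev_chain c bs) (ev_chain c' bs).
Proof.
move=> + Ec Ed.
pose R c c' := size c = (sumn (map snd bs)).+1 -> size c' = size c /\
  exists s, cong d (size bs).+1 s (ev_chain c bs) (ev_chain c' bs).
suff H : perm_eq c c' -> R c c' by move=> /H /(_ Ec)[].
have Rr s : R s s.
  by split=> //; exists false; apply: cong_eq; rewrite scale1r.
have Rt s t u : R s t -> R t u -> R s u.
  move=> st tu Es; have [Et [s1 C1]] := st Es.
  have [|Eu [s2 C2]] := tu; first by rewrite Et.
  by split; [rewrite Eu|exists (s1 (+) s2); apply: cong_trans C1 C2].
have Rs a x s1 s2 : R (a :: s1 ++ x :: s2) (x :: s1 ++ a :: s2).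
  move=> Es; split; first by rewrite /= !size_cat.
  have [|l1 [b [u1 [u2 [l2 H]]]]] := @arrange_split X s1 s2 bs.
    by move: Es; rewrite /= size_cat => -[].
  have Eb : bs = lasts (l1 ++ (b, u1 ++ x :: u2) :: l2).
    by rewrite -H lasts_arrange //; case: Es.
  have Esz : size bs = (size (args l1) + size (args l2)).+1.
    by rewrite Eb !size_map size_cat /= addnS.
  rewrite Esz /ev_chain !H /tab_term !map_cat; apply: cong_star.
  rewrite !degs_args -Ed Ec Eb /= /lasts !map_cat sumn_cat !size_cat /= !size_map.
  by rewrite size_cat /=; lia.
apply: perm_eq_adjacent => // -[|a s] x y t; first exact: (Rs x y [::] t).
(* Behind the head [a], the neighbours [x] and [y] are transposed by three exchanges with the head:
   [a] with [x], [x] with [y], [y] with [a]. *)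
apply: (Rt _ _ _ (Rs a x s (y :: t))).
have := Rs x y (rcons s a) t; rewrite !cat_rcons => H; apply: (Rt _ _ _ H).
exact: (Rs y a s (x :: t)).
Qed.

Hypothesis char2 : 2%:R != 0 :> k.

(** [2 u] lies in the subspace and 2 is invertible. *)
Lemma fil_cong_opp d n u : cong d n true u u -> fil d n u.
Proof.
rewrite /cong /sgn expr1 scaleN1r opprK -mulr2n -scaler_nat => H.
by rewrite -[u]scale1r -(mulVf char2) -scalerA; apply: lspanZ.
Qed.

Lemma fil_repeat_head x t ts d : par x -> (2 + deg t + degs ts)%N = d ->
  fil d (size ts + 2) (ev (app (Leaf x) (Node (Leaf x) t :: ts))).
Proof. by move=> px /(@cong_head x x _ _ _); rewrite px => /fil_cong_opp. Qed.

(** For two equal odd tails the sign in [cong_tails] is [true] whatever the parity of [u'], so the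
    term is congruent to its opposite. *)
Lemma fil_repeat_tail a u u' b ts d : par b -> size u = size u' ->
  (3 + 2 * size u + degs ts)%N = d ->
  fil d (size ts + 3)
    (ev (app (Leaf a) (lmul u (Leaf b) :: lmul u' (Leaf b) :: ts))).
Proof.
move=> pb uu' E; rewrite -[_ :: _ :: ts]/([:: _; _] ++ ts) app_cat ev_app.
apply: (@fil_amul (3 + 2 * size u) 3); [|exact: E|by rewrite addnC].
apply: fil_cong_opp.
have := @cong_tails a u u' (Leaf b) (Leaf b) (3 + 2 * size u) uu'.
by rewrite /= pb /=; apply; lia.
Qed.

End Spanning.

Lemma unsorted_split (T : Type) (r : rel T) s : ~~ sorted r s ->
  exists s1 x y s2, s = s1 ++ x :: y :: s2 /\ ~~ r x y.
Proof.
case: s => //= x s; elim: s x => //= y s IH x.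
rewrite negb_and => /orP[rxy|/IH[s1 [z [t [s2 [-> rzt]]]]]].
  by exists [::], x, y, s.
by exists (x :: s1), z, t, s2.
Qed.

Lemma count2_perm (T : eqType) (x : T) s : (1 < count_mem x s)%N ->
  exists t, perm_eq s (x :: x :: t).
Proof.
move=> H; have xs : x \in s by rewrite -has_pred1 has_count (ltnW H).
have xs' : x \in rem x s.
  by rewrite -has_pred1 has_count count_mem_rem eqxx subn_gt0.
exists (rem x (rem x s)); rewrite (permPl (perm_to_rem xs)) perm_cons.
exact: perm_to_rem.
Qed.

Lemma not_uniq_count (T : eqType) (s : seq T) : ~~ uniq s ->
  exists2 x, x \in s & (1 < count_mem x s)%N.
Proof.
move=> nu; case: (boolP (has (fun x => 1 < count_mem x s)%N s)) => [/hasP//|].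
move/hasPn => H; case/negP: nu; apply: count_mem_uniq => x.
case: (boolP (x \in s)) => [xs|/count_memPn//].
have := H x xs; rewrite -leqNgt; move: xs; rewrite -has_pred1 has_count.
by case: (count_mem x s) => [|[]].
Qed.

(** * Reduction of terms to supertableaux *)

Section TableauxSpan.
Variables (k : fieldType) (A : GDNsuperalg k).
Variables (disp : Order.disp_t) (X : orderType disp) (par : X -> bool).
Variable i : X -> A.
Hypothesis i_part : forall a, i a \in @gdn_part k A (par a).
Hypothesis char2 : 2%:R != 0 :> k.

Local Notation ev := (eval_term (@gdn_mul k A) i).
Local Notation fil := (@fil k A X i).

Definition tab_span (d : nat) : A -> Prop :=
  lspan (fun u => exists a ls,
    [/\ u = ev (tab_term a ls), tab_data_ok par a ls & deg (tab_term a ls) = d]).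

(** Conditions (i) and (ii) merged into one lexicographic order, total so that arguments can be
    sorted. *)
Definition last_ge (p q : X * nat) : bool :=
  (q.2 < p.2)%N || (q.2 == p.2) && (q.1 <= p.1)%O.

Lemma last_ge_total : total last_ge.
Proof.
move=> [a m] [b n]; rewrite /last_ge /=.
by case: (ltngtP m n) => //= _; apply: le_total.
Qed.

Lemma last_ge_trans : transitive last_ge.
Proof.
move=> [b n] [a m] [c p]; rewrite /last_ge /=.
case: (ltngtP n m) => //= [nm _|->].
  by case: (ltngtP p n) => //= [pn|->]; rewrite ?(ltn_trans pn nm) ?nm.
by case: (ltngtP p m) => //= _ ab bc; apply: le_trans bc ab.
Qed.

Lemma last_ge_anti : antisymmetric last_ge.
Proof.
move=> [a m] [b n]; rewrite /last_ge /=.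
by case: (ltngtP m n) => //= -> /le_anti ->.
Qed.

Lemma sorted_last0 b bs : sorted last_ge ((b, 0%N) :: bs) ->
  sumn (map snd bs) = 0%N.
Proof.
move/(order_path_min last_ge_trans); elim: bs => //= -[c n] bs IH.
by rewrite /last_ge /= => /andP[/andP[/eqP-> _] /IH].
Qed.

Lemma deg_tab (a : X) ls :
  deg (tab_term a ls) = (size (flatten (map snd ls)) + size ls).+1.
Proof.
rewrite -[tab_term a ls]/(app (Leaf a) (args ls)) deg_app degs_args.
by rewrite size_flatten_snd add1n.
Qed.

(** Sorting leaves only (iv) and (v) to fail, that is, an odd letter repeats. Equal last letters are
    handled by [fil_repeat_tail], equal chain letters by [fil_repeat_head] after both copies are
    moved to the front of the chain. *)
Lemma fil_non_tab a ls d : deg (tab_term a ls) = d ->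
  sorted last_ge (lasts ls) ->
  sorted (fun x y : X => (y <= x)%O) (a :: flatten (map snd ls)) ->
  ~~ tab_data_ok par a ls -> fil d (size ls).+1 (ev (tab_term a ls)).
Proof.
move=> Ed Sl Sc; rewrite /tab_data_ok Sc.
have -> : sorted geq (map (fun p => (size p.2).+1) ls).
  move: Sl; rewrite /lasts !sorted_map; apply: sub_sorted => p q /=.
  by rewrite /last_ge /= => /orP[/ltnW //|/andP[/eqP->]].
set c := a :: _; rewrite !andTb negb_and => /orP[].
  case/unsorted_split => ls1 [[b w] [[b' w'] [ls2 [Els]]]].
  rewrite negb_imply => /andP[/= /eqP Ew]; rewrite negb_and negbK.
  have -> /= : (b' <= b)%O.
    move: Sl; rewrite Els /lasts map_cat => /cat_sorted2[_ /= /andP[+ _]].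
    by rewrite /last_ge /= Ew ltnn eqxx.
  move=> /and3P[pb _ /eqP Eb]; rewrite -{}Eb in Els.
  have [|s Es] := @app_perm _ _ _ _ _ i_part (Leaf a) (args ls)
     (lmul w (Leaf b) :: lmul w' (Leaf b) :: args (ls1 ++ ls2)).
    apply/permP => f; rewrite /args Els !map_cat /= !count_cat /=.
    by rewrite addnCA; congr (_ + _)%N; rewrite addnCA.
  rewrite [ev _]Es; apply: lspanZ.
  have -> : (size ls).+1 = (size (args (ls1 ++ ls2)) + 3)%N.
    by rewrite size_map Els !size_cat /=; lia.
  apply: fil_repeat_tail => //.
  rewrite -Ed deg_tab size_flatten_snd degs_args Els /lasts !map_cat !sumn_cat.
  by rewrite !size_cat /= Ew; lia.
case/not_uniq_count => x; rewrite mem_filter => /andP[px _].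
rewrite count_filter => H; have {H}/count2_perm[t ct] : (1 < count_mem x c)%N.
  by apply: leq_trans H _; apply: sub_count => y /= /andP[].
have Ec : size c = (sumn (map snd (lasts ls))).+1 by rewrite /= size_flatten_snd.
have [|s C] := @cong_chain _ _ _ _ _ i_part c (x :: x :: t) (lasts ls) d ct Ec.
  by rewrite -Ed deg_tab size_map.
move: C; rewrite /ev_chain /c arrangeK -/c => C.
have El : sumn (map snd (lasts ls)) = (size t).+1.
  by have := perm_size ct; rewrite Ec => -[].
have Esz : size (lasts ls) = size ls by rewrite size_map.
(* The chain has at least two letters, so the first argument of the sorted shape is longer than one
   letter: otherwise [sorted_last0] would leave only the head in the chain. *)
have El0 := El; case: (lasts ls) El Sl Esz C => [|[b [|r]] bs] // El.
  by move/sorted_last0 => E0; rewrite /= E0 in El.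
move=> _ Esz C; set bs' := _ :: bs in Esz C *.
rewrite -Esz -[ev _](subrK (sgn k s *: ev_chain i [:: x, x & t] bs')).
apply: lspanD C _.
apply: lspanZ; set ls' := arrange (drop r t) bs.
have -> : (size ((b, r.+1) :: bs)).+1 = (size (args ls') + 2)%N.
  by rewrite size_map size_arrange /= addn2.
apply: (@fil_repeat_head _ _ _ _ _ i_part char2 x (lmul (take r t) (Leaf b))) => //.
have Er : size (drop r t) = sumn (map snd bs).
  by rewrite size_drop; move: El => /=; lia.
rewrite deg_lmul degs_args lasts_arrange // size_arrange -Ed deg_tab.
rewrite size_flatten_snd El0 -Esz /= size_takel; move: El => /=; lia.
Qed.

(** Arguments are sorted exactly, up to sign, and the chain modulo more arguments. The hypothesis on
    [fil] absorbs this error, and also the sorted term if it is not a tableau. *)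
Lemma simple_tab a ls d : deg (tab_term a ls) = d ->
  (forall v, fil d (size ls).+1 v -> tab_span d v) ->
  tab_span d (ev (tab_term a ls)).
Proof.
move=> Ed H.
have cong_span s u v : cong i d (size ls).+1 s u v ->
    tab_span d v -> tab_span d u.
  by move=> /H C Sv; rewrite -[u](subrK (sgn k s *: v)); apply/lspanD/lspanZ.
pose r := relpre (fun p : X * seq X => (p.1, size p.2)) last_ge.
pose ls1 := sort r ls.
have pls : perm_eq ls ls1 by rewrite perm_sym; apply/permPl/perm_sort.
have Els1 : size ls1 = size ls by rewrite (perm_size pls).
have [s E1] : exists s, ev (tab_term a ls) = sgn k s *: ev (tab_term a ls1).
  by apply: (app_perm i_part (Leaf a)); apply: perm_map.
have Ed1 : deg (tab_term a ls1) = d.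
  by rewrite -Ed !deg_tab Els1 (perm_size (perm_flatten (perm_map _ pls))).
rewrite E1; apply: lspanZ.
set bs := lasts ls1.
have Sbs : sorted last_ge bs.
  by rewrite sorted_map; apply: sort_sorted => p q; apply: last_ge_total.
pose c := a :: flatten (map snd ls1).
pose c' := sort (fun x y : X => (y <= x)%O) c.
have pc : perm_eq c c' by rewrite perm_sym; apply/permPl/perm_sort.
have Ec : size c = (sumn (map snd bs)).+1 by rewrite /= size_flatten_snd.
have [|s' C] := @cong_chain _ _ _ _ _ i_part c c' bs d pc Ec.
  by rewrite -Ed1 deg_tab /= size_map.
rewrite size_map Els1 /ev_chain in C.
have Sc' : sorted (fun x y : X => (y <= x)%O) c'.
  by apply: sort_sorted => x y; apply: le_total.
case: c' pc Sc' C => [/perm_size|a' cs' pc Sc']; first by rewrite Ec.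
rewrite /c /bs arrangeK => /cong_span; apply.
have Ecs' : size cs' = sumn (map snd bs).
  by have := perm_size pc; rewrite Ec => -[].
set ls2 := arrange cs' bs.
have Els2 : size ls2 = size ls by rewrite size_arrange size_map.
have Ed2 : deg (tab_term a' ls2) = d.
  rewrite -Ed1 !deg_tab flatten_arrange // Els2 Els1 Ecs'.
  by rewrite size_flatten_snd.
case: (boolP (tab_data_ok par a' ls2)) => ok.
  by apply: lspan_gen; exists a', ls2.
apply: H; rewrite -Els2; apply: fil_non_tab => //.
  by rewrite lasts_arrange.
by rewrite flatten_arrange.
Qed.

(** A tableau with at most one argument is itself a simple term. *)
Lemma simple_args (us : seq (term X)) :
  (forall u, u \in us -> exists b ls, u = tab_term b ls) ->
  (exists u b ts, [/\ u \in us, u = app (Leaf b) ts & (1 < size ts)%N])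
  \/ exists ls, us = args ls.
Proof.
elim: us => [|u us IH] H; first by right; exists [::].
have [|[u' [b [ts [u'us Eu' lt1]]]]|[ls ->]] := IH.
- by move=> v vus; apply: H; rewrite inE vus orbT.
- by left; exists u', b, ts; rewrite inE u'us orbT.
have [|b [vs Eu]] := H u; first by rewrite inE eqxx.
case: vs Eu => [|[c w] [|q vs]] Eu.
- by right; exists ((b, [::]) :: ls); rewrite Eu.
- by right; exists ((c, b :: w) :: ls); rewrite Eu.
- by left; exists u, b, (args [:: (c, w), q & vs]); rewrite inE eqxx.
Qed.

(** The outer induction on the degree turns arguments into tableaux. The inner one, on [d - n], ends
    because a term of degree [d] has fewer than [d] arguments. *)
Theorem fil_tab_span d n v : fil d n v -> tab_span d v.
Proof.
elim/ltn_ind: d n v => d IHd n v.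
have [m] := ubnP (d - n); elim: m n v => // m IHm n v dnm.
apply: lspanS => _ [a [ts [-> Ed nts]]].
have ltd : (size ts < d)%N by rewrite -Ed add1n ltnS size_degs.
have Hfil w : fil d (size ts).+1 w -> tab_span d w by apply: IHm; lia.
pose P u := exists (b : X) ls, u = tab_term b ls.
apply: lspanS (@expand_args _ _ _ i P (Leaf a) ts _); last first.
  move=> u uts; have [b [us Eu]] := term_app u.
  have Hu : fil (deg u) 0 (ev u).
    by rewrite {2}Eu; apply: fil_app => //; rewrite Eu deg_app.
  apply: lspanS (IHd (deg u) _ 0%N _ Hu) => [_ [c [ls [-> _ Edl]]]|].
    by apply: lspan_gen; exists (tab_term c ls); split=> //; exists c, ls.
  by rewrite -Ed add1n ltnS (degs_perm (perm_to_rem uts)) degs_cons leq_addr.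
move=> _ [us [-> Es Edu PH]]; case: (simple_args PH).
  (* An argument that itself has two arguments or more is moved to the end, where [fil_mul2] raises
     the number of arguments. *)
  move=> [u [b [vs [uus Eu lt1]]]]; apply: Hfil.
  have [|s ->] := @app_perm _ _ _ _ _ i_part (Leaf a) us (rcons (rem u us) u).
    by rewrite perm_sym perm_rcons perm_sym perm_to_rem.
  apply: lspanZ; rewrite app_rcons /=.
  have -> : (size ts).+1 = (size (rem u us) + 2)%N.
    by rewrite -Es (perm_size (perm_to_rem uus)) /=; lia.
  apply: (@fil_mul2 _ _ _ _ _ i_part a (rem u us) (ev u) d (deg u)).
    by rewrite {2}Eu; apply: fil_app lt1; rewrite Eu deg_app.
  by rewrite -Ed -Edu (degs_perm (perm_to_rem uus)) degs_cons; lia.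
case=> ls Eus; rewrite Eus; apply: simple_tab.
  by rewrite (deg_app (Leaf a) (args ls)) -Eus Edu.
by have -> : size ls = size ts by rewrite -Es Eus size_map.
Qed.

End TableauxSpan.

(** * Generation by terms *)

Section TermSubalgebra.
Variables (k : fieldType) (A : GDNsuperalg k) (X : eqType) (par : X -> bool).
Variable i : X -> A.
Hypothesis i_part : forall a, i a \in @gdn_part k A (par a).

Local Notation ev := (eval_term (@gdn_mul k A) i).

(** Made boolean by classical logic, so that a subtype can be formed. *)
Definition term_span : {pred A} :=
  fun v => `[< lspan (fun u => exists t, u = ev t) v >].

Lemma term_spanP v :
  reflect (lspan (fun u => exists t, u = ev t) v) (v \in term_span).
Proof. exact: asboolP. Qed.

Fact term_span_submod : GRing.submod_closed term_span.
Proof.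
split=> [|a u v /term_spanP Hu /term_spanP Hv]; apply/term_spanP; first by left.
by apply/lspanD => //; apply: lspanZ.
Qed.

HB.instance Definition _ :=
  GRing.isSubmodClosed.Build k A term_span term_span_submod.

Definition term_alg := {x : A | x \in term_span}.
HB.instance Definition _ := SubChoice.on term_alg.
HB.instance Definition _ := [SubChoice_isSubLmodule of term_alg by <:].

Lemma term_span_mul u v : u \in term_span -> v \in term_span ->
  gdn_mul u v \in term_span.
Proof.
move=> /term_spanP Hu /term_spanP Hv; apply/term_spanP.
apply: lspan_lin (mul_linearl v) _ Hu => _ [t ->].
apply: lspan_lin (mul_linearr _) _ Hv => _ [t' ->].
by apply: lspan_gen; exists (Node t t').
Qed.

Definition term_mul (x y : term_alg) : term_alg :=
  exist _ (gdn_mul (val x) (val y)) (term_span_mul (valP x) (valP y)).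

Definition term_part (b : bool) : {pred term_alg} :=
  fun x => val x \in @gdn_part k A b.

(** Only the existence of homogeneous components needs an argument: terms evaluate to homogeneous
    elements, so the components of a combination of terms are again such combinations. *)
Lemma term_alg_gdn : gdn_axioms term_part term_mul.
Proof.
have [[[Gs Gd Gi] [Bl Br] Gm] Gx] := gdn_ax A.
split; first split; first split.
- move=> b; have [G0 G1] := Gs b; split=> [|a u v]; rewrite !unfold_in //=.
  exact: G1.
- move=> [x /= Sx]; suff [x0 [x1 [p0 p1 S0 S1 E]]] : exists x0 x1,
      [/\ x0 \in @gdn_part k A false, x1 \in @gdn_part k A true,
          x0 \in term_span, x1 \in term_span & x = x0 + x1].
    exists (exist _ x0 S0), (exist _ x1 S1); split=> //; exact/val_inj.
  move/term_spanP: Sx.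
  elim=> [|a _ v [t ->] _ [x0 [x1 [p0 p1 S0 S1 ->]]]].
    by exists 0, 0; rewrite addr0 !rpred0; split=> //; exact: (proj1 (Gs _)).
  have St : ev t \in term_span by apply/term_spanP/lspan_gen; exists t.
  have := ev_part i_part t; case: (tpar par t) => pt.
    exists x0, (a *: ev t + x1); split=> //; last by rewrite addrCA.
      by case: (Gs true) => _; apply.
    by rewrite rpredD ?rpredZ.
  exists (a *: ev t + x0), x1; split=> //; last by rewrite addrA.
    by case: (Gs false) => _; apply.
  by rewrite rpredD ?rpredZ.
- by move=> x x0 x1; apply/val_inj/Gi.
- by split=> a x y z; apply: val_inj; [apply: Bl|apply: Br].
- by move=> b c x y; apply: Gm.
move=> b c d x y z px py pz; have [E1 E2] := Gx b c d _ _ _ px py pz.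
by split; apply: val_inj.
Qed.

(** The morphism to the subalgebra of terms, followed by the inclusion, fixes the generators, hence
    is the identity by uniqueness. *)
Lemma free_term_span : is_free_GDN par i ->
  forall v, lspan (fun u => exists t, u = ev t) v.
Proof.
move=> [_ Hfree] v; pose B := GDNSuperalg term_alg_gdn.
have Si a : i a \in term_span by apply/term_spanP/lspan_gen; exists (Leaf a).
pose j a : B := exist _ (i a) (Si a).
have [[f [[fL fp fM] fj]] _] := Hfree B j i_part.
have [_ /(_ (fun x => val (f x)) id)E] := Hfree A i i_part.
rewrite -[v]E //; first exact/term_spanP/(valP (f v)).
- split=> [a x y|b x /fp|x y]; rewrite ?fL ?fM //.
- by split.
- by move=> a; rewrite fj.
Qed.

End TermSubalgebra.

(** * A differential supercommutative model *)

Section Model.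
Variables (k : fieldType) (X : choiceType) (par : X -> bool).

Local Notation sgn := (sgn k).

(* The letter (a, n) stands for the n-th derivative of the generator a. *)
Local Notation word := (seq (X * nat)).

Definition word_par (w : word) : bool :=
  foldr (fun x b => par x.1 (+) b) false w.

Lemma word_par_cat u v : word_par (u ++ v) = word_par u (+) word_par v.
Proof. by elim: u => //= x u ->; rewrite addbA. Qed.

(** Functionals on the free associative algebra that vanish on the ideal generated by the
    supercommutators of letters. *)
Definition ssym (lam : word -> k) : Prop := forall u x y v,
  lam (u ++ x :: y :: v) = sgn (par x.1 && par y.1) * lam (u ++ y :: x :: v).

Definition pairing (lam : word -> k) (p : seq (k * word)) : k :=
  \sum_(c <- p) c.1 * lam c.2.

Lemma pairing0 p : pairing (fun=> 0) p = 0.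
Proof. by rewrite /pairing big1 // => c _; rewrite mulr0. Qed.

Lemma pairing_lin a lam mu p :
  pairing (fun w => a * lam w + mu w) p = a * pairing lam p + pairing mu p.
Proof.
rewrite /pairing mulr_sumr -big_split; apply: eq_bigr => c _ /=.
by rewrite mulrDr mulrCA.
Qed.

Lemma pairing_cat lam p q :
  pairing lam (p ++ q) = pairing lam p + pairing lam q.
Proof. by rewrite /pairing big_cat. Qed.

Lemma ssym_shift lam u : ssym lam -> ssym (fun v => lam (u ++ v)).
Proof. by move=> Sl v x y w; rewrite !catA. Qed.

Lemma ssym_pairing (lam : word -> word -> k) p :
  (forall v, ssym (lam^~ v)) -> ssym (fun u => pairing (lam u) p).
Proof.
move=> Sl u x y v; rewrite /pairing mulr_sumr; apply: eq_bigr => c _.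
by rewrite (Sl _ u) mulrCA.
Qed.

Definition indist (p q : seq (k * word)) : bool :=
  `[< forall lam, ssym lam -> pairing lam p = pairing lam q >].

Fact indist_refl : reflexive indist. Proof. by move=> p; apply/asboolP. Qed.
Fact indist_sym : symmetric indist.
Proof. by move=> p q; apply/asboolP/asboolP => H l Sl; rewrite H. Qed.
Fact indist_trans : transitive indist.
Proof.
move=> q p r /asboolP H1 /asboolP H2; apply/asboolP => l Sl.
by rewrite H1 ?H2.
Qed.

Canonical indist_equiv := EquivRel indist indist_refl indist_sym indist_trans.

(* The free differential supercommutative algebra is the quotient of the free
   associative algebra on [word] by the supercommutators; two polynomials are
   identified when all supersymmetric functionals agree on them. *)
Definition model := {eq_quot indist}.
HB.instance Definition _ := Choice.on model.

Definition cls (p : seq (k * word)) : model := \pi_({eq_quot indist}) p.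
(** Supersymmetry of [lam] guarantees independence of the representative ([fn_cls]); fixing one
    makes [fn] linear in arbitrary [lam]. *)
Definition fn (lam : word -> k) (x : model) : k :=
  pairing lam (repr (x : {eq_quot indist})).

Lemma fn_cls lam p : ssym lam -> fn lam (cls p) = pairing lam p.
Proof.
move=> Sl; rewrite /fn /cls.
have /eqmodP/asboolP := reprK (\pi_({eq_quot indist}) p).
by apply.
Qed.

(** Reduces identities in the model to identities between scalars. *)
Lemma fn_ext x y : (forall lam, ssym lam -> fn lam x = fn lam y) -> x = y.
Proof.
move=> H; rewrite -[x](@reprK _ {eq_quot indist}).
by rewrite -[y](@reprK _ {eq_quot indist}); apply/eqmodP/asboolP.
Qed.

Lemma fn0 x : fn (fun=> 0) x = 0. Proof. exact: pairing0. Qed.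

Lemma fn_lin a lam mu x :
  fn (fun w => a * lam w + mu w) x = a * fn lam x + fn mu x.
Proof. exact: pairing_lin. Qed.

Lemma ssym_fn (lam : word -> word -> k) x :
  (forall v, ssym (lam^~ v)) -> ssym (fun u => fn (lam u) x).
Proof. exact: ssym_pairing. Qed.

Definition model0 : model := cls [::].
Definition model_scale (a : k) (x : model) : model :=
  cls [seq (a * c.1, c.2) | c <- repr (x : {eq_quot indist})].
Definition model_add (x y : model) : model :=
  cls (repr (x : {eq_quot indist}) ++ repr (y : {eq_quot indist})).
Definition model_mul (x y : model) : model :=
  cls [seq (c.1 * e.1, c.2 ++ e.2) | c <- repr (x : {eq_quot indist}),
                                     e <- repr (y : {eq_quot indist})].

Lemma fn_model0 lam : ssym lam -> fn lam model0 = 0.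
Proof. by move=> Sl; rewrite fn_cls // /pairing big_nil. Qed.

Lemma fn_model_add lam x y : ssym lam ->
  fn lam (model_add x y) = fn lam x + fn lam y.
Proof. by move=> Sl; rewrite fn_cls // pairing_cat. Qed.

Lemma fn_model_scale lam a x : ssym lam ->
  fn lam (model_scale a x) = a * fn lam x.
Proof.
move=> Sl; rewrite fn_cls // /pairing big_map mulr_sumr.
by apply: eq_bigr => c _; rewrite mulrA.
Qed.

Lemma fn_model_mul lam x y : ssym lam ->
  fn lam (model_mul x y) = fn (fun u => fn (fun v => lam (u ++ v)) y) x.
Proof.
move=> Sl; rewrite fn_cls // /pairing big_allpairs_dep /=.
rewrite {2}/fn /pairing; apply: eq_bigr => c _; rewrite mulr_sumr.
by apply: eq_bigr => e _; rewrite mulrA.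
Qed.

Fact model_addA : associative model_add.
Proof. by move=> x y z; apply: fn_ext => l Sl; rewrite !fn_model_add // addrA. Qed.
Fact model_addC : commutative model_add.
Proof. by move=> x y; apply: fn_ext => l Sl; rewrite !fn_model_add // addrC. Qed.
Fact model_add0 : left_id model0 model_add.
Proof.
by move=> x; apply: fn_ext => l Sl; rewrite fn_model_add // fn_model0 // add0r.
Qed.
Fact model_addN : left_inverse model0 (model_scale (-1)) model_add.
Proof.
move=> x; apply: fn_ext => l Sl.
by rewrite fn_model_add // fn_model_scale // fn_model0 // mulN1r addNr.
Qed.
HB.instance Definition _ :=
  GRing.isZmodule.Build model model_addA model_addC model_add0 model_addN.

Fact model_scaleA a b x :
  model_scale a (model_scale b x) = model_scale (a * b) x.
Proof. by apply: fn_ext => l Sl; rewrite !fn_model_scale // mulrA. Qed.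
Fact model_scale1 : left_id 1 model_scale.
Proof. by move=> x; apply: fn_ext => l Sl; rewrite !fn_model_scale // mul1r. Qed.
Fact model_scaleDr : right_distributive model_scale +%R.
Proof.
move=> a x y; apply: fn_ext => l Sl.
by rewrite !(fn_model_scale, fn_model_add) // mulrDr.
Qed.
Fact model_scaleDl x : {morph model_scale^~ x : a b / a + b}.
Proof.
move=> a b; apply: fn_ext => l Sl.
by rewrite !(fn_model_scale, fn_model_add) // mulrDl.
Qed.
HB.instance Definition _ := GRing.Zmodule_isLmodule.Build k model
  model_scaleA model_scale1 model_scaleDr model_scaleDl.

Lemma fnD lam x y : ssym lam -> fn lam (x + y) = fn lam x + fn lam y.
Proof. exact: fn_model_add. Qed.

Lemma fnZ lam a (x : model) : ssym lam -> fn lam (a *: x) = a * fn lam x.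
Proof. exact: fn_model_scale. Qed.

Lemma fn_zero lam : ssym lam -> fn lam 0 = 0.
Proof. exact: fn_model0. Qed.

(* [supp P x]: x is represented by a combination of words satisfying P. *)
Definition supp (P : word -> Prop) (x : model) : Prop := forall lam,
  ssym lam -> (forall w, P w -> lam w = 0) -> fn lam x = 0.

Lemma suppD P x y : supp P x -> supp P y -> supp P (x + y).
Proof. by move=> Hx Hy l Sl Pl; rewrite fnD // Hx // Hy // addr0. Qed.

Lemma suppZ P a x : supp P x -> supp P (a *: x).
Proof. by move=> Hx l Sl Pl; rewrite fnZ // Hx // mulr0. Qed.

Lemma supp0 P : supp P 0.
Proof. by move=> l Sl _; rewrite fn_zero. Qed.

Lemma supp_sub (P Q : word -> Prop) x :
  (forall w, P w -> Q w) -> supp P x -> supp Q x.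
Proof. by move=> PQ Hx l Sl Ql; apply: Hx => // w /PQ/Ql. Qed.

Lemma supp_mul (P Q S : word -> Prop) x y :
  (forall u v, P u -> Q v -> S (u ++ v)) ->
  supp P x -> supp Q y -> supp S (model_mul x y).
Proof.
move=> PQS Hx Hy l Sl Sl0; rewrite fn_model_mul //; apply: Hx => [|u Pu].
  by apply: ssym_fn => v u a b u'; rewrite -!catA; apply: Sl.
by apply: Hy => [|v Qv]; [apply: ssym_shift|apply/Sl0/PQS].
Qed.

Definition wcls (w : word) : model := cls [:: (1, w)].

Lemma fn_wcls lam w : ssym lam -> fn lam (wcls w) = lam w.
Proof. by move=> Sl; rewrite fn_cls // /pairing big_seq1 mul1r. Qed.

Lemma supp_wcls (P : word -> Prop) w : P w -> supp P (wcls w).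
Proof. by move=> Pw l Sl Pl; rewrite fn_wcls // Pl. Qed.

Lemma wcls_mul u v : model_mul (wcls u) (wcls v) = wcls (u ++ v).
Proof.
apply: fn_ext => l Sl; rewrite fn_model_mul // !fn_wcls //.
  exact: ssym_shift.
by apply: ssym_fn => w u' a b v'; rewrite -!catA; apply: Sl.
Qed.

(** The terms of the Leibniz expansion of the derivative of [w], one for each position. *)
Fixpoint incs (w : word) : seq word :=
  if w is x :: w' then ((x.1, x.2.+1) :: w') :: map (cons x) (incs w')
  else [::].

Lemma incs_cat u v :
  incs (u ++ v) = [seq u' ++ v | u' <- incs u] ++ [seq u ++ v' | v' <- incs v].
Proof.
elim: u => [|x u IH] /=; first by rewrite map_id.
by rewrite IH map_cat -!map_comp.
Qed.

(** The transpose of the derivation. *)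
Definition dual (lam : word -> k) (w : word) : k := \sum_(w' <- incs w) lam w'.

Lemma dual_cat lam u v : dual lam (u ++ v)
  = dual (fun u' => lam (u' ++ v)) u + dual (fun v' => lam (u ++ v')) v.
Proof. by rewrite /dual incs_cat big_cat /= !big_map. Qed.

Lemma dual_cons lam x w : dual lam (x :: w)
  = lam ((x.1, x.2.+1) :: w) + dual (fun w' => lam (x :: w')) w.
Proof. by rewrite /dual big_cons big_map. Qed.

(** Differentiating a letter keeps its parity, hence the Koszul sign; so the derivation descends to
    the quotient. *)
Lemma ssym_dual lam : ssym lam -> ssym (dual lam).
Proof.
move=> Sl u x y v; rewrite !dual_cat !dual_cons mulrDr; congr (_ + _).
  by rewrite /dual mulr_sumr; apply: eq_bigr => w _; apply: Sl.
rewrite mulrDr mulrDr addrCA; congr (_ + (_ + _)); try exact: Sl.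
by rewrite /dual mulr_sumr; apply: eq_bigr => w _; apply: Sl.
Qed.

Definition model_D (x : model) : model :=
  cls [seq (c.1, w) | c <- repr (x : {eq_quot indist}), w <- incs c.2].

Lemma fn_D lam x : ssym lam -> fn lam (model_D x) = fn (dual lam) x.
Proof.
move=> Sl; rewrite fn_cls // /pairing big_allpairs_dep /=.
by rewrite /fn /pairing; apply: eq_bigr => c _; rewrite /dual mulr_sumr.
Qed.

Lemma supp_D (P Q : word -> Prop) x :
  (forall w w', P w -> w' \in incs w -> Q w') -> supp P x -> supp Q (model_D x).
Proof.
move=> PQ Hx l Sl Ql; rewrite fn_D //; apply: Hx => [|w Pw].
  exact: ssym_dual.
by rewrite /dual big_seq big1 // => w' /(PQ _ _ Pw)/Ql.
Qed.

Lemma word_par_incs w w' : w' \in incs w -> word_par w' = word_par w.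
Proof.
elim: w w' => //= x w IH w'; rewrite inE => /orP[/eqP->//|].
by case/mapP => u /IH E ->; rewrite /= E.
Qed.

Definition model_part (b : bool) : {pred model} :=
  fun x => `[< supp (fun w => word_par w = b) x >].

Lemma model_partP b x :
  reflect (supp (fun w => word_par w = b) x) (x \in model_part b).
Proof. exact: asboolP. Qed.

(** The transpose of the projection onto parity [b]. *)
Definition restrict (b : bool) (lam : word -> k) (w : word) : k :=
  if word_par w == b then lam w else 0.

Lemma ssym_restrict b lam : ssym lam -> ssym (restrict b lam).
Proof.
move=> Sl u x y v; rewrite /restrict !word_par_cat /= Sl.
by rewrite [par x.1 (+) (_ (+) _)]addbCA; case: ifP => _ //; rewrite mulr0.
Qed.

Lemma fn_restrict lam x :
  fn lam x = fn (restrict false lam) x + fn (restrict true lam) x.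
Proof.
rewrite -[fn (restrict false lam) x]mul1r -fn_lin; congr fn.
apply: funext => w; rewrite /restrict mul1r.
by case: (word_par w); rewrite ?add0r ?addr0.
Qed.

Lemma model_grading : is_grading model_part.
Proof.
split.
- move=> b; split=> [|a u v /model_partP Hu /model_partP Hv]; apply/model_partP.
    exact: supp0.
  by apply: suppD => //; apply: suppZ.
- move=> x.
  pose xb b := cls [seq c <- repr (x : {eq_quot indist}) | word_par c.2 == b].
  have Hb b lam : ssym lam -> fn lam (xb b) = fn (restrict b lam) x.
    move=> Sl; rewrite fn_cls // /fn /pairing big_filter big_mkcond /=.
    by apply: eq_bigr => c _; rewrite /restrict; case: ifP; rewrite ?mulr0.
  have Hp b : xb b \in model_part b.
    apply/model_partP => l Sl l0; rewrite Hb // -[RHS](fn0 x); congr fn.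
    by apply: funext => w; rewrite /restrict; case: eqP => // /l0.
  exists (xb false), (xb true); split=> //.
  by apply: fn_ext => l Sl; rewrite fnD // !Hb // -fn_restrict.
- move=> x /model_partP H0 /model_partP H1; apply: fn_ext => l Sl.
  rewrite fn_restrict fn_zero // H1 ?H0 ?addr0 //; try exact: ssym_restrict.
    by move=> w; rewrite /restrict => ->.
  by move=> w; rewrite /restrict => ->.
Qed.

Lemma model_mul_bilinear : is_bilinear model_mul.
Proof.
split=> a x y z; apply: fn_ext => l Sl;
  rewrite fnD // fnZ // !fn_model_mul // ?fnD ?fnZ //.
- by apply: ssym_fn => w u a' b v; rewrite -!catA; apply: Sl.
- by apply: ssym_fn => w u a' b v; rewrite -!catA; apply: Sl.
rewrite -fn_lin; congr fn; apply: funext => u.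
by rewrite fnD ?fnZ //; apply: ssym_shift.
Qed.

Lemma model_mulA x y z :
  model_mul x (model_mul y z) = model_mul (model_mul x y) z.
Proof.
apply: fn_ext => l Sl; rewrite !fn_model_mul //; last first.
  by apply: ssym_fn => w u a' b v; rewrite -!catA; apply: Sl.
congr fn; apply: funext => u; rewrite fn_model_mul; last exact: ssym_shift.
by congr fn; apply: funext => v; congr fn; apply: funext => w; rewrite catA.
Qed.

Lemma ssym_move lam v w : ssym lam ->
  lam (v ++ w) = sgn (word_par v && word_par w) * lam (w ++ v).
Proof.
have H l x u t : ssym l ->
    l (x :: u ++ t) = sgn (par x.1 && word_par u) * l (u ++ x :: t).
  move=> Sl; elim/last_ind: u t => [|u y IHu] t.
    by rewrite andbF /sgn expr0 mul1r.
  rewrite cat_rcons IHu Sl mulrA sgn_add -cats1 word_par_cat /= addbF.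
  by rewrite -andb_addr -catA.
elim: v lam => [|x v IH] lam Sl; first by rewrite /sgn expr0 mul1r cats0.
rewrite /= (IH (fun u => lam (x :: u))); last exact: (ssym_shift [:: x]).
by rewrite H // mulrA sgn_add addbC -andb_addl.
Qed.

Lemma fn_exchange (lam : word -> word -> k) x y :
  fn (fun u => fn (lam u) y) x = fn (fun v => fn (lam^~ v) x) y.
Proof.
rewrite /fn /pairing; under eq_bigr do rewrite mulr_sumr.
rewrite exchange_big /=; apply: eq_bigr => e _; rewrite mulr_sumr.
by apply: eq_bigr => c _; rewrite mulrCA.
Qed.

Lemma model_mulC b c x y : x \in model_part b -> y \in model_part c ->
  model_mul x y = sgn (b && c) *: model_mul y x.
Proof.
move=> /model_partP Hx /model_partP Hy; apply: fn_ext => l Sl.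
rewrite fnZ // !fn_model_mul // fn_exchange.
(* The difference of the two sides is one functional evaluated at [y]. It has to vanish on words of
   parity [c], which in turn is checked on words of parity [b] for [x]. *)
apply/eqP; rewrite -subr_eq0 addrC -mulNr -fn_lin; apply/eqP.
have Sr v : ssym (fun u => l (u ++ v)).
  by move=> u a a' u'; rewrite -!catA; apply: Sl.
apply: Hy => [|v vc].
  move=> u a a' v; rewrite mulrDr mulrCA; congr (_ * _ + _).
    by rewrite (ssym_fn (lam := fun u v => l (u ++ v))).
  by rewrite (ssym_fn (lam := fun v u => l (u ++ v))) // => v'; apply: ssym_shift.
rewrite -fn_lin; apply: Hx => [u a a' u'|u ub].
  rewrite mulrDr mulrCA; congr (_ * _ + _); last exact: Sr.
  by rewrite (ssym_shift v Sl).
by rewrite (ssym_move u) // ub vc mulNr addNr.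
Qed.

Lemma dual_fn (lam : word -> word -> k) x w :
  dual (fun u => fn (lam u) x) w = fn (fun v => dual (lam^~ v) w) x.
Proof.
rewrite /dual /fn /pairing exchange_big; apply: eq_bigr => c _.
by rewrite mulr_sumr.
Qed.

Lemma model_DM x y :
  model_D (model_mul x y)
  = model_mul (model_D x) y + model_mul x (model_D y).
Proof.
apply: fn_ext => l Sl.
have S1 : ssym (fun u => fn (fun v => l (u ++ v)) y).
  by apply: ssym_fn => w u a' b v; rewrite -!catA; apply: Sl.
have S2 : ssym (fun u => fn (fun v => l (u ++ v)) (model_D y)).
  by apply: ssym_fn => w u a' b v; rewrite -!catA; apply: Sl.
rewrite fnD // fn_D // !fn_model_mul //; last exact: ssym_dual.
rewrite fn_D // -[fn (dual _) x]mul1r -fn_lin; congr fn; apply: funext => u.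
rewrite fn_D ?dual_fn; last exact: ssym_shift.
rewrite mul1r -[X in _ = X + _]mul1r -fn_lin; congr fn; apply: funext => v.
by rewrite mul1r -dual_cat.
Qed.

Lemma model_D_linear : is_linear model_D.
Proof.
move=> a x y; apply: fn_ext => l Sl.
rewrite fn_D // [RHS]fnD // [in RHS]fnZ // !fn_D // fnD ?fnZ //.
  exact: ssym_dual.
exact: ssym_dual.
Qed.

Lemma model_dsc : dsc_axioms model_part model_mul model_D.
Proof.
split.
- split; [exact: model_grading|exact: model_mul_bilinear|].
  move=> b c x y /model_partP Hx /model_partP Hy; apply/model_partP.
  by apply: supp_mul Hx Hy => u v <- <-; rewrite word_par_cat.
- exact: model_mulA.
- exact: model_mulC.
- split; first exact: model_D_linear.
  move=> b x /model_partP Hx; apply/model_partP; apply: supp_D Hx => w w' <-.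
  exact: word_par_incs.
- exact: model_DM.
Qed.

End Model.

(** * Leading words and independence *)

Section LeadingWord.
Variables (k : fieldType) (X : choiceType) (par : X -> bool).

Local Notation model := (@model k X par).
Local Notation mul := (@model_mul k X par).
Local Notation der := (@model_D k X par).
Local Notation wcls := (@wcls k X par).
Local Notation supp := (@supp k X par).
Local Notation word := (seq (X * nat)).

Definition gen (a : X) : model := wcls [:: (a, 0%N)].

Local Notation ev := (eval_term (fun x y : model => mul x (der y)) gen).

Definition tot (w : word) : nat := sumn [seq x.2 | x <- w].
Definition qtot (w : word) : nat := sumn [seq (x.2 ^ 2)%N | x <- w].

Lemma tot_cat u v : tot (u ++ v) = (tot u + tot v)%N.
Proof. by rewrite /tot map_cat sumn_cat. Qed.

Lemma qtot_cat u v : qtot (u ++ v) = (qtot u + qtot v)%N.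
Proof. by rewrite /qtot map_cat sumn_cat. Qed.

Lemma qtot_perm u v : perm_eq u v -> qtot u = qtot v.
Proof. by move=> uv; apply/perm_sumn/perm_map. Qed.

Lemma tot_incs w w' : w' \in incs w -> tot w' = (tot w).+1.
Proof.
elim: w w' => //= x w IH w'; rewrite inE => /orP[/eqP->//|].
by case/mapP => u /IH E ->; rewrite /tot /= -/(tot u) E addnS.
Qed.

(** [(n + 1)^2 = n^2 + 2 n + 1], and the order [n] of a single letter is at most [tot w]. *)
Lemma qtot_incs w w' : w' \in incs w -> (qtot w' <= qtot w + 2 * tot w + 1)%N.
Proof.
elim: w w' => //= x w IH w'; rewrite inE => /orP[/eqP->|].
  by rewrite /qtot /tot /= -/(qtot w) -/(tot w); nia.
case/mapP => u /IH E ->; rewrite /qtot /tot /= -/(qtot w) -/(tot w) -/(qtot u).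
by nia.
Qed.

Definition zeros (w : seq X) : word := [seq (x, 0%N) | x <- w].

Lemma tot_zeros w : tot (zeros w) = 0%N.
Proof. by elim: w. Qed.

Lemma qtot_zeros w : qtot (zeros w) = 0%N.
Proof. by elim: w. Qed.

(** The leading word of the derivative of a simple term of length [r]: [w] has [r - 1] letters, and
    the last letter takes all [r] derivatives. *)
Definition arg_word (b : X) (w : seq X) : word :=
  rcons (zeros w) (b, (size w).+1).

Lemma qtot_arg_word b w : qtot (arg_word b w) = ((size w).+1 ^ 2)%N.
Proof. by rewrite /arg_word -cats1 qtot_cat qtot_zeros /qtot /= addn0. Qed.

(* Among the words with N derivatives, sum of squares N^2 is attained exactly
   when all derivatives sit on one letter; in [D (a_r D(a_(r-1) ... D a_1))]
   the innermost one can only hit a_1. *)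
Lemma lead_simple b w :
  supp (fun u => tot u = (size w).+1 /\ (qtot u < (size w).+1 ^ 2)%N)
    (der (ev (simple_term b w)) - wcls (arg_word b w)).
Proof.
elim: w => [|x w IH].
  have -> : der (ev (simple_term b [::])) = wcls (arg_word b [::]).
    apply: fn_ext => l Sl; rewrite fn_D // !fn_wcls //; last exact: ssym_dual.
    by rewrite /dual big_seq1.
  by rewrite subrr; apply: supp0.
set s := simple_term b w in IH *; set V := arg_word b w in IH *.
rewrite -[ev _]/(mul (gen x) (der (ev s))).
have [_ Br] := model_mul_bilinear k par.
have DL := @model_D_linear k X par.
rewrite -[der (ev s)](subrK (wcls V)) (is_linearD _ _ (Br^~ (gen x))).
rewrite (is_linearD _ _ DL) wcls_mul -addrA; apply: suppD.
  (* Lower words stay lower: with [N = (size w).+1], a sum of squares below [N^2] grows by at most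
     [2 N + 1]. *)
  apply: (@supp_D _ _ _ (fun u => tot u = (size w).+1 /\
    (qtot u < (size w).+1 ^ 2)%N)).
    move=> u u' [Et Eq] uu'; rewrite (tot_incs uu') Et; split=> //.
    by have := qtot_incs uu'; rewrite Et /=; nia.
  apply: (@supp_mul _ _ _ (fun u => u = [:: (x, 0%N)])) IH.
    by move=> u v -> [Et Eq].
  exact: supp_wcls.
move=> l Sl l0; rewrite -scaleN1r fnD // fnZ // fn_D // !fn_wcls //; last first.
  exact: ssym_dual.
(* Differentiating the last letter gives the leading word, which cancels; any other letter gives a
   sum of squares [N^2 + 1], below [(N + 1)^2]. *)
rewrite mulN1r /V /arg_word -!cats1 catA dual_cat.
rewrite [X in _ + X - _]/dual /= big_seq1 addrK.
rewrite /dual big_seq big1 // => u uw; apply: l0.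
have Eq := qtot_incs uw; have Et := tot_incs uw.
rewrite tot_cat qtot_cat Et; move: Eq.
rewrite -[(x, 0%N) :: zeros w]/(zeros (x :: w)) tot_zeros qtot_zeros.
by rewrite /tot /qtot /=; split; nia.
Qed.

Definition args_word (ls : seq (X * seq X)) : word :=
  flatten [seq arg_word p.1 p.2 | p <- ls].

Definition tab_word (a : X) (ls : seq (X * seq X)) : word :=
  (a, 0%N) :: args_word ls.

(** Sums of squares add under concatenation, so only the product of the two leading words reaches
    the top value. *)
Lemma lead_app t ls W :
  supp (fun u => qtot u < qtot W)%N (ev t - wcls W) ->
  supp (fun u => qtot u < qtot (W ++ args_word ls))%N
    (ev (app t (args ls)) - wcls (W ++ args_word ls)).
Proof.
elim: ls t W => [|[b w] ls IH] t W Ht; first by rewrite cats0.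
rewrite /args_word /= -/(args_word ls) catA; apply: IH => /=.
set s := simple_term b w; set V := arg_word b w.
have [Bl Br] := model_mul_bilinear k par.
have Hs : supp (fun u => qtot u < qtot V)%N (der (ev s) - wcls V).
  by apply: (supp_sub _ (@lead_simple b w)) => u [_]; rewrite qtot_arg_word.
have Ht' : supp (fun u => qtot u <= qtot W)%N (ev t).
  rewrite -[ev t](subrK (wcls W)); apply: suppD; last exact: supp_wcls.
  by apply: (supp_sub _ Ht) => u /ltnW.
have -> : mul (ev t) (der (ev s)) - wcls (W ++ V)
    = mul (ev t) (der (ev s) - wcls V) + mul (ev t - wcls W) (wcls V).
  rewrite (is_linearB _ _ (Br^~ (ev t))).
  rewrite (is_linearB _ _ (fun a x y => Bl a x y (wcls V))).
  by rewrite wcls_mul addrA subrK.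
apply: suppD.
  by apply: supp_mul Ht' Hs => u v uW vV; rewrite !qtot_cat -addnS leq_add.
apply: supp_mul Ht (@supp_wcls _ _ _ (fun v => v = V) V erefl) => u v uW ->.
by rewrite !qtot_cat ltn_add2r.
Qed.

Lemma lead_tab a ls :
  supp (fun u => qtot u < qtot (tab_word a ls))%N
    (ev (tab_term a ls) - wcls (tab_word a ls)).
Proof.
rewrite /tab_word -cat1s; apply: (@lead_app (Leaf a)).
by rewrite subrr; apply: supp0.
Qed.

(* Inversions are counted with respect to the positions in M, so that the
   odd letters of M, being distinct, need no order. *)
Fixpoint inversions (M w : word) : bool :=
  if w is x :: w' then
    par x.1 && odd (count (fun y => par y.1 && (index y M < index x M)%N) w')
    (+) inversions M w'
  else false.

(** Reads off the coefficient of the monomial [M], whose rearrangements count with their Koszul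
    signs. *)
Definition coef_at (M w : word) : k :=
  if perm_eq w M then sgn k (inversions M w) else 0.

(** The inversions starting in [u] depend only on the multiset of the letters that follow, so they
    cancel. *)
Lemma inversions_cat M u v w : perm_eq v w ->
  inversions M (u ++ v) (+) inversions M (u ++ w)
  = inversions M v (+) inversions M w.
Proof.
move=> vw; elim: u => //= x u <-.
rewrite !count_cat (permP vw) addbACA addbb addFb.
by [].
Qed.

(** Exchanging two adjacent odd letters changes the number of inversions by one because they differ,
    which is what the uniqueness hypothesis ensures. *)
Lemma ssym_coef M : uniq [seq x <- M | par x.1] -> ssym par (coef_at M).
Proof.
move=> uM u x y v; rewrite /coef_at.
have pxy : perm_eq (u ++ x :: y :: v) (u ++ y :: x :: v).
  by rewrite perm_cat2l -[x :: y :: v]/([:: x] ++ [:: y] ++ v) perm_catCA.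
rewrite -(permPl pxy); case: ifP => [pM|]; last by rewrite mulr0.
have pxy' : perm_eq (x :: y :: v) (y :: x :: v) by rewrite -(perm_cat2l u).
have Exy : inversions M (x :: y :: v) (+) inversions M (y :: x :: v)
    = par x.1 && par y.1.
  rewrite /= !oddD !oddb; move: (odd _) (odd _) (inversions _ _) => o1 o2 o3.
  have xM : x \in M by rewrite -(perm_mem pM) mem_cat inE eqxx orbT.
  have yM : y \in M by rewrite -(perm_mem pM) mem_cat !inE eqxx !orbT.
  case px: (par x.1); case py: (par y.1); rewrite //= ?andbF ?andbT ?addbF;
    try by case: o1; case: o2; case: o3.
  have : index x M != index y M.
    apply: contraTneq uM => /(index_inj x xM yM) Exy.
    rewrite -(perm_uniq (perm_filter _ pM)) filter_cat /= px py Exy.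
    by rewrite cat_uniq /= inE eqxx !andbF.
  by case: ltngtP => // _ _; case: o1; case: o2; case: o3.
have := inversions_cat M u pxy'; rewrite Exy sgn_add => <-.
by rewrite -addbA addbb addbF.
Qed.

Lemma coef_at_neq0 M : coef_at M M != 0.
Proof. by rewrite /coef_at perm_refl signr_eq0. Qed.

Lemma perm_filterD (T : eqType) (p : pred T) s :
  uniq [seq x <- s | p x] -> uniq [seq x <- s | ~~ p x] -> uniq s.
Proof.
move=> u1 u2; rewrite -(perm_uniq (permEl (perm_filterC p s))) cat_uniq u1 u2.
rewrite andbT; apply/hasPn => x; rewrite !mem_filter /= => /andP[npx _].
by rewrite (negbTE npx).
Qed.

(** Together with [tab_word_pos] this recovers the tableau from its leading word: letters of order 0
    form the chain, the others are the [a_{i,1}] with order [r_i]. *)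
Lemma tab_word_zero a ls : [seq x <- tab_word a ls | x.2 == 0%N]
  = zeros (a :: flatten (map snd ls)).
Proof.
rewrite /tab_word /=; congr (_ :: _); elim: ls => //= -[b w] ls IH.
rewrite /args_word /= filter_cat -/(args_word ls) IH /zeros map_cat.
rewrite /arg_word filter_rcons /= filter_map /=; congr (_ ++ _).
by rewrite (eq_filter (a2 := predT)) // filter_predT.
Qed.

Lemma tab_word_pos a ls : [seq x <- tab_word a ls | x.2 != 0%N]
  = [seq (p.1, p.2.+1) | p <- lasts ls].
Proof.
rewrite /tab_word /=; elim: ls => //= -[b w] ls IH.
rewrite /args_word /= filter_cat -/(args_word ls) IH.
rewrite /arg_word filter_rcons /= filter_map /=.
by rewrite (eq_filter (a2 := pred0)) // filter_pred0.
Qed.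



End LeadingWord.

(** * Linear independence of supertableaux in the model *)

Section TableauxIndependent.
Variables (k : fieldType) (disp : Order.disp_t) (X : orderType disp).
Variable par : X -> bool.

Local Notation model := (@model k X par).
Local Notation ev := (eval_term
  (fun x y : model => @model_mul k X par x (@model_D k X par y)) (@gen k X par)).

(** Conditions (i), (ii) and (v) in one relation. Its transitivity extends (v) from neighbours to
    arguments at any distance. *)
Definition last_gt (p q : X * nat) : bool :=
  last_ge p q && ~~ [&& par p.1, par q.1 & p == q].

Lemma last_gt_trans : transitive last_gt.
Proof.
move=> q p r /andP[pq npq] /andP[qr _]; apply/andP; split.
  exact: last_ge_trans pq qr.
apply: contra npq => /and3P[pp _ /eqP Er]; rewrite -Er in qr.
have -> : q = p by apply: last_ge_anti; rewrite pq qr.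
by rewrite pp eqxx.
Qed.

Lemma tab_ok_sorted a ls : tab_data_ok par a ls -> sorted last_gt (lasts ls).
Proof.
case/and4P => S1 S2 _ _; rewrite /lasts sorted_map; rewrite sorted_map in S1.
move: (introT andP (conj S1 S2)); rewrite -sorted_relI => S.
apply: sub_sorted S => -[b v] [c w] /= /andP[].
rewrite /last_gt /last_ge /= xpair_eqE => le; case: eqP => [->|ne] /=.
  by rewrite ltnn eqxx andbT eq_sym.
rewrite !andbF andbT => _; rewrite orbC.
by move: le ne; rewrite ltnS leq_eqVlt => /orP[/eqP|->//]; rewrite ?orbT // => ->.
Qed.

(** Odd letters of order 0 are distinct by (iv), those of positive order by (v). *)
Lemma tab_word_uniq a ls : tab_data_ok par a ls ->
  uniq [seq x <- tab_word a ls | par x.1].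
Proof.
move=> ok; have Sl := tab_ok_sorted ok; case/and4P: ok => _ _ _ uc.
have swap (T : Type) (p q : pred T) t :
    [seq x <- [seq x <- t | p x] | q x] = [seq x <- [seq x <- t | q x] | p x].
  by rewrite -!filter_predI; apply: eq_filter => x; apply: andbC.
apply: (@perm_filterD _ (fun x => x.2 == 0%N)); rewrite swap.
  rewrite tab_word_zero /zeros filter_map map_inj_uniq //.
  by move=> x y [].
rewrite tab_word_pos filter_map map_inj_uniq; last by move=> [b n] [c m] [-> ->].
rewrite uniq_pairwise; move: Sl; rewrite (sorted_pairwise last_gt_trans).
move/(pairwise_filter (fun p => par p.1)).
apply: (sub_in_pairwise (P := fun p => par p.1)); last exact: filter_all.
by move=> p q pp pq /andP[_]; rewrite [par p.1]pp [par q.1]pq.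
Qed.

(** A sorted list is determined by its multiset; this applies to the chain and to the shape. *)
Lemma tab_word_inj a a' ls ls' :
  tab_data_ok par a ls -> tab_data_ok par a' ls' ->
  perm_eq (tab_word a ls) (tab_word a' ls') -> (a, ls) = (a', ls').
Proof.
move=> ok ok' pW.
have Ec : a :: flatten (map snd ls) = a' :: flatten (map snd ls').
  apply: (@sorted_eq _ (fun x y : X => (y <= x)%O)).
  - by move=> x y z xy yz; apply: le_trans yz xy.
  - by move=> x y; rewrite andbC; apply: le_anti.
  - by case/and4P: ok.
  - by case/and4P: ok'.
  have := perm_filter (fun x => x.2 == 0%N) pW; rewrite !tab_word_zero => p.
  by have := perm_map fst p; rewrite /zeros -!map_comp !map_id.
have El : lasts ls = lasts ls'.
  apply: (@sorted_eq _ (@last_ge _ X)).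
  - exact: last_ge_trans.
  - exact: last_ge_anti.
  - by apply: sub_sorted (tab_ok_sorted ok) => p q /andP[].
  - by apply: sub_sorted (tab_ok_sorted ok') => p q /andP[].
  have := perm_filter (fun x => x.2 != 0%N) pW; rewrite !tab_word_pos => p.
  apply: perm_map_inj p => -[b n] [c m] [-> ->]; exact: erefl.
case: Ec => -> Ec; congr (_, _).
by rewrite -[ls]arrangeK -[ls']arrangeK Ec El.
Qed.

(** Coefficients are killed in decreasing order of the sum of squares [q] of the leading word. *)
Lemma tab_data_indep (ds : seq (X * seq (X * seq X))) (c : _ -> k) :
  uniq ds -> (forall d, d \in ds -> tab_data_ok par d.1 d.2) ->
  \sum_(d <- ds) c d *: ev (tab_term d.1 d.2) = 0 ->
  forall d, d \in ds -> c d = 0.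
Proof.
move=> uds ok E d.
pose q (d : X * seq (X * seq X)) := qtot (tab_word d.1 d.2).
(* [B] merely bounds all values of [q], so that [B - q d] measures the descent. *)
pose B := (\sum_(d <- ds) q d)%N.
have [m] := ubnP (B - q d); elim: m d => // m IHm d dm dds.
have hi d' : d' \in ds -> (q d < q d')%N -> c d' = 0.
  move=> d'ds lt; apply: IHm => //.
  have : (q d' <= B)%N by rewrite /B (big_rem _ d'ds) leq_addr.
  by move: dm; lia.
pose l := coef_at k par (tab_word d.1 d.2).
have Sl : ssym par l by apply/ssym_coef/tab_word_uniq/ok.
have fn_sum (s : seq (X * seq (X * seq X))) (f : _ -> model) :
    fn l (\sum_(x <- s) f x) = \sum_(x <- s) fn l (f x).
  by elim: s => [|x s IHs]; rewrite ?big_nil ?fn_zero // !big_cons fnD // IHs.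
have := fn_zero Sl; rewrite -{1}E fn_sum (bigD1_seq d) //=.
have lead d' : (q d' <= q d)%N ->
    fn l (ev (tab_term d'.1 d'.2)) = l (tab_word d'.1 d'.2).
  move=> qd'; rewrite -[ev _](subrK (wcls k par (tab_word d'.1 d'.2))).
  rewrite fnD // fn_wcls // (@lead_tab _ _ _ _ _ l Sl) ?add0r // => w qw.
  rewrite /l /coef_at ifF //; apply/negbTE/negP => /qtot_perm Ew.
  by move: qw; rewrite Ew ltnNge qd'.
(* Tableaux with larger [q] have coefficient zero by induction. Every other one contributes only
   through its leading word, which is not a rearrangement of that of [d]. *)
rewrite big_seq_cond big1 => [|d' /andP[d'ds d'd]]; last first.
  rewrite fnZ //; have [lt|le] := ltnP (q d) (q d'); first by rewrite hi ?mul0r.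
  rewrite lead // /l /coef_at ifF ?mulr0 //; apply: contraNF d'd => pW.
  have := tab_word_inj (ok _ d'ds) (ok _ dds) pW.
  by rewrite -!surjective_pairing => ->.
rewrite addr0 fnZ // lead // => /eqP; rewrite mulf_eq0 => /orP[/eqP//|].
by rewrite (negbTE (coef_at_neq0 _ _ _)).
Qed.

Theorem tableaux_indep (s : seq (term X)) (c : term X -> k) :
  uniq s -> (forall t, t \in s -> is_supertableau par t) ->
  \sum_(t <- s) c t *: ev t = 0 -> forall t, t \in s -> c t = 0.
Proof.
move=> us Hs; have [ds [Es ok]] : exists ds : seq (X * seq (X * seq X)),
    s = [seq tab_term d.1 d.2 | d <- ds] /\
    forall d, d \in ds -> tab_data_ok par d.1 d.2.
  elim: s {us} Hs => [|t s IH] Hs; first by exists [::].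
  have [|ds [-> ok]] := IH; first by move=> u us; apply: Hs; rewrite inE us orbT.
  have [|a [ls [ok' ->]]] := Hs t; first by rewrite inE eqxx.
  exists ((a, ls) :: ds); split=> // d; rewrite inE => /orP[/eqP->//|].
  exact: ok.
rewrite Es big_map => E t /mapP[d dds ->].
apply: (@tab_data_indep ds (fun d => c (tab_term d.1 d.2))) => //.
by apply: (@map_uniq _ _ (fun d => tab_term d.1 d.2)); rewrite -Es.
Qed.

End TableauxIndependent.

(** * The product [u D(v)] and the conclusion *)

(** The associator [E] equals [u v D(D(z))], supersymmetric in [u] and [v]; right supercommutativity
    exchanges [D(y)] and [D(z)]. *)
Lemma dsc_gdn (k : fieldType) (B : DSCalg k) :
  gdn_axioms (@dsc_part k B) (fun x y => dsc_mul x (dsc_D y)).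
Proof.
have [[Bg [Bl Br] Bm] BA BC [DL Dp] DM] := dsc_ax B.
split.
  split=> //.
    by split=> a x y z; [apply: Bl|rewrite DL; apply: Br].
  by move=> b c x y px py; apply/Bm/Dp.
move=> b c d x y z px py pz; rewrite !DM.
have E u v : dsc_mul u (dsc_mul (dsc_D v) (dsc_D z) + dsc_mul v (dsc_D (dsc_D z)))
   - dsc_mul (dsc_mul u (dsc_D v)) (dsc_D z)
   = dsc_mul (dsc_mul u v) (dsc_D (dsc_D z)).
  by rewrite (is_linearD _ _ (Br^~ u)) !BA addrAC subrr add0r.
split.
  rewrite !E (BC _ _ _ _ px py).
  by rewrite (is_linearZ _ _ (fun a x y => Bl a x y (dsc_D (dsc_D z)))).
rewrite -!BA (BC _ _ _ _ (Dp _ _ py) (Dp _ _ pz)).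
by rewrite (is_linearZ _ _ (Br^~ x)).
Qed.

Lemma eval_term_hom (X A B : Type) (m : A -> A -> A) (n : B -> B -> B)
    (i : X -> A) (j : X -> B) (f : A -> B) t :
  (forall x y, f (m x y) = n (f x) (f y)) -> (forall a, f (i a) = j a) ->
  f (eval_term m i t) = eval_term n j t.
Proof. by move=> fM fi; elim: t => //= u <- v <-. Qed.

Theorem theorem3p4 (k : fieldType) (hchar : (2%:R : k) != 0)
  (d : Order.disp_t) (X : orderType d) (par : X -> bool)
  (hwo : forall P : X -> Prop, (exists x, P x) ->
           exists m, P m /\ forall y, P y -> (m <= y)%O)
  (F : GDNsuperalg k) (i : X -> F) (hF : @is_free_GDN k X par F i)
  (K : DSCalg k) (j : X -> K) (hK : @is_free_DSC k X par K j) :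
  is_linear_basis (is_supertableau par) (eval_term (@gdn_mul k F) i)
  /\ forall phi : F -> K,
       is_linear phi ->
       preserves_parity (@gdn_part k F) (@dsc_part k K) phi ->
       (forall x y : F, phi (gdn_mul x y) = dsc_mul (phi x) (dsc_D (phi y))) ->
       (forall a, phi (i a) = j a) ->
       injective phi.
Proof.
have i_part := hF.1.
pose B := DSCAlg (@model_dsc k X par).
pose BG := GDNSuperalg (dsc_gdn B).
have gen_part a : gen k par a \in @dsc_part k B (par a).
  by apply/model_partP/supp_wcls; rewrite /= addbF.
have span v : exists (s : seq (term X)) (c : term X -> k),
    [/\ uniq s, forall t, t \in s -> is_supertableau par t
      & v = \sum_(t <- s) c t *: eval_term (@gdn_mul k F) i t].
  apply: lspan_lin_comb; apply: lspanS (free_term_span i_part hF v) => _ [t ->].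
  have [a [ts ->]] := term_app t.
  have := @fil_app _ F X i a ts _ 0 erefl isT.
  move/(fil_tab_span i_part hchar).
  apply: lspanS => _ [b [ls [-> ok _]]]; apply: lspan_gen.
  by exists (tab_term b ls) => //; exists b, ls.
have sum_lin (V W : lmodType k) (f : V -> W) (s : seq (term X)) c e :
    is_linear f ->
    f (\sum_(t <- s) c t *: e t) = \sum_(t <- s) c t *: f (e t).
  move=> fL; elim: s => [|t s IH]; first by rewrite !big_nil is_linear0.
  by rewrite !big_cons fL IH.
split.
  split=> [v|s c us Hs E]; first by have [s [c [_ Hs ->]]] := span v; exists s, c.
  (* The morphism [f] from the free algebra carries a linear relation between tableaux to the
     model. *)
  apply: (tableaux_indep us Hs).
  have [[f [[fL _ fM] fi]] _] := hF.2 BG (gen k par) gen_part.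
  have := is_linear0 fL; rewrite -[X in f X]E (sum_lin _ _ _ _ _ _ fL) => E0.
  apply: etrans _ E0; apply: eq_bigr => t _.
  by rewrite (eval_term_hom _ fM fi).
(* The kernel element [x - y] is expanded in tableaux. Since [g] after [phi] evaluates terms in the
   model, independence there makes all coefficients zero. *)
move=> phi phiL _ phiM phii x y Exy; apply/eqP; rewrite -subr_eq0; apply/eqP.
have := is_linearB x y phiL; rewrite Exy subrr.
have [s [c [us Hs ->]]] := span (x - y) => E.
have [[g [[gL _ gM gD] gj]] _] := hK.2 B (gen k par) gen_part.
have gphiM u v : g (phi (gdn_mul u v)) = dsc_mul (g (phi u)) (dsc_D (g (phi v))).
  by rewrite phiM gM gD.
have gphii a : g (phi (i a)) = gen k par a by rewrite phii gj.
rewrite big_seq big1 // => t ts.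
rewrite (@tableaux_indep _ _ _ par s c) ?scale0r //.
have := is_linear0 gL; rewrite -[X in g X]E.
rewrite (sum_lin _ _ _ _ _ _ phiL) (sum_lin _ _ _ _ _ _ gL).
move=> E0; apply: etrans _ E0; apply: eq_bigr => u _.
congr (_ *: _); apply/esym.
exact: (@eval_term_hom _ _ _ _ _ _ _ (fun v => g (phi v)) u gphiM gphii).
Qed.
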